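(* Let $(A,G,\alpha)$ be a $C^*$-dynamical system with $G$ a locally compact abelian group. Let $a,b,c\in A$ be positive $\alpha$-integrable elements such that $a\leq b$ and $b\stackrel{rc}{\sim}c$. Then $a\stackrel{rc}{\sim}c$.
   Context: $\alpha$ is a strongly continuous action of $G$ (with fixed Haar measure $dt$ and Pontryagin dual $\widehat G$) on the $C^*$-algebra $A$. Integrability: a function $f:G\to A$ is unconditionally integrable if it is Bochner integrable over every relatively compact (measurable) $K\subseteq G$ and the net $\{\int_K f(t)\,dt\}_K$, indexed by the relatively compact subsets ordered by inclusion, converges in norm; the limit is denoted $\int^u_G f(t)\,dt$. An element $a\in A$ is $\alpha$-integrable if for every $b\in A$ the functions $t\mapsto \alpha_t(a)b$ and $t\mapsto b\,\alpha_t(a)$ are unconditionally integrable. Fourier coefficients: write $\langle x,t\rangle$ for the duality between $x\in\widehat G$ and $t\in G$. For $a$ $\alpha$-integrable and $x\in\widehat G$, $E_x(a)$ is the element of the multiplier algebra $M(A)$ determined by $E_x(a)b=\int^u_G\langle x,t\rangle\alpha_t(a)b\,dt$ and $bE_x(a)=\int^u_G\langle x,t\rangle b\,\alpha_t(a)\,dt$ for $b\in A$. Relative continuity: for $\alpha$-integrable $a,b$ write $a\stackrel{rc}{\sim}b$ if $\|E_{xz}(a)E_y(b)-E_x(a)E_{zy}(b)\|\to0$ as $z\to e$ in $\widehat G$, uniformly in $x,y\in\widehat G$. *)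

(* Defs.v *)
From HB Require Import structures.
From mathcomp Require Import all_boot all_order all_algebra.
From mathcomp Require Import complex.
From mathcomp Require Import all_classical all_reals all_analysis.
Import Order.TTheory GRing.Theory Num.Theory.
Import numFieldNormedType.Exports.

Set Implicit Arguments.
Unset Strict Implicit.
Unset Printing Implicit Defensive.

Local Open Scope classical_set_scope.
Local Open Scope ring_scope.
Local Open Scope complex_scope.

(* In a normed module over R[i] the norm takes its values in R[i]; these values
   are nonnegative reals, and [rnorm] views them in R. *)
Definition rnorm (R : realType) (V : normedModType R[i]) (v : V) : R :=
  complex.Re `|v|.

(* C*-algebras, not necessarily unital: a complex Banach space with a compatible
   product and involution satisfying the C*-identity. *)
HB.mixin Record CompleteNormedModule_isCstarAlgebra (R : realType) A
    & CompleteNormedModule R[i] A := {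
  cmul : A -> A -> A;
  star : A -> A;
  cmulA : forall a b c, cmul a (cmul b c) = cmul (cmul a b) c;
  cmulDl : forall a b c, cmul (a + b) c = cmul a c + cmul b c;
  cmulDr : forall a b c, cmul a (b + c) = cmul a b + cmul a c;
  cmulZl : forall (k : R[i]) a b, cmul (k *: a) b = k *: cmul a b;
  cmulZr : forall (k : R[i]) a b, cmul a (k *: b) = k *: cmul a b;
  cmul_norm : forall a b, `|cmul a b| <= `|a| * `|b| :> R[i];
  starK : involutive star;
  starD : {morph star : a b / a + b};
  starZ : forall (k : R[i]) a, star (k *: a) = k^* *: star a;
  starM : forall a b, star (cmul a b) = cmul (star b) (star a);
  cstar_identity : forall a, `|cmul (star a) a| = `|a| ^+ 2 :> R[i]
}.

#[short(type="cstarAlgType")]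
HB.structure Definition CstarAlgebra (R : realType) :=
  {A of CompleteNormedModule R[i] A & CompleteNormedModule_isCstarAlgebra R A}.

Notation "a *c b" := (cmul a b) (at level 40, left associativity) : ring_scope.

Section CstarTheory.
Context {R : realType} {A : cstarAlgType R}.
Implicit Types a b c : A.

Lemma cmul0l a : 0 *c a = 0.
Proof. by rewrite -[0 in LHS](scale0r 0) cmulZl scale0r. Qed.

Lemma cmul0r a : a *c 0 = 0.
Proof. by rewrite -[0 in LHS](scale0r 0) cmulZr scale0r. Qed.

Lemma cmulBl a b c : (a - b) *c c = a *c c - b *c c.
Proof. by rewrite -scaleN1r cmulDl cmulZl scaleN1r. Qed.

Lemma cmulBr a b c : a *c (b - c) = a *c b - a *c c.
Proof. by rewrite -scaleN1r cmulDr cmulZr scaleN1r. Qed.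

End CstarTheory.

Section PositiveElements.
Context {R : realType} {A : cstarAlgType R}.

Definition is_positive (a : A) : Prop := exists h : A, a = star h *c h.

Definition cle (a b : A) : Prop := is_positive (b - a).

End PositiveElements.

(* The multiplier algebra M(A) as the algebra of double centralizers (L, R) of A:
   m acts on b by m b = L b and b m = R b. *)
Section Multipliers.
Context {R : realType} {A : cstarAlgType R}.

Record multiplier := Multiplier {
  lmult : {linear A -> A};
  rmult : {linear A -> A};
  lmult_continuous : continuous lmult;
  rmult_continuous : continuous rmult;
  lmultM : forall a b, lmult (a *c b) = lmult a *c b;
  rmultM : forall a b, rmult (a *c b) = a *c rmult b;
  multE : forall a b, a *c lmult b = rmult a *c b
}.

HB.instance Definition _ := gen_eqMixin multiplier.
HB.instance Definition _ := gen_choiceMixin multiplier.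

Program Definition mult0 : multiplier :=
  @Multiplier (\0 : {linear A -> A}) (\0 : {linear A -> A}) _ _ _ _ _.
Next Obligation.
by move=> x; exact: cvg_cst.
Qed.
Next Obligation.
by move=> x; exact: cvg_cst.
Qed.
Next Obligation.
by move=> a b; rewrite /= [RHS]cmul0l.
Qed.
Next Obligation.
by move=> a b; rewrite /= [RHS]cmul0r.
Qed.
Next Obligation.
by move=> a b; rewrite [LHS]cmul0r [RHS]cmul0l.
Qed.

Program Definition multB (m p : multiplier) : multiplier :=
  @Multiplier (lmult m \- lmult p : {linear A -> A})
              (rmult m \- rmult p : {linear A -> A}) _ _ _ _ _.
Next Obligation.
by move=> m p x; exact: (cvgB (@lmult_continuous m x) (@lmult_continuous p x)).
Qed.
Next Obligation.
by move=> m p x; exact: (cvgB (@rmult_continuous m x) (@rmult_continuous p x)).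
Qed.
Next Obligation.
by move=> m p a b; rewrite /= !lmultM cmulBl.
Qed.
Next Obligation.
by move=> m p a b; rewrite /= !rmultM cmulBr.
Qed.
Next Obligation.
by move=> m p a b; rewrite /= cmulBl cmulBr !multE.
Qed.

Program Definition multM (m p : multiplier) : multiplier :=
  @Multiplier (lmult m \o lmult p : {linear A -> A})
              (rmult p \o rmult m : {linear A -> A}) _ _ _ _ _.
Next Obligation.
by move=> m p x; exact: (continuous_comp (@lmult_continuous p x) (@lmult_continuous m _)).
Qed.
Next Obligation.
by move=> m p x; exact: (continuous_comp (@rmult_continuous m x) (@rmult_continuous p _)).
Qed.
Next Obligation.
by move=> m p a b; rewrite /= !lmultM.
Qed.
Next Obligation.
by move=> m p a b; rewrite /= !rmultM.
Qed.
Next Obligation.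
by move=> m p a b; rewrite /= !multE.
Qed.

Definition mult_norm (m : multiplier) : R :=
  sup [set rnorm (lmult m b) | b in [set b : A | rnorm b <= 1]].

End Multipliers.
Arguments multiplier {R} A.

Section BochnerIntegral.
Context {R : realType} {d : measure_display} {T : measurableType d}.
Context {V : completeNormedModType R[i]}.
Variable mu : {measure set T -> \bar R}.

Definition simple_on (K : set T) (s : T -> V) : Prop :=
  [/\ finite_set (range s),
      forall v, measurable (s @^-1` [set v]) &
      forall v, v != 0 -> (mu (K `&` s @^-1` [set v]) < +oo)%E].

Definition simple_integral (K : set T) (s : T -> V) : V :=
  \sum_(v \in range s) (fine (mu (K `&` s @^-1` [set v])))%:C *: v.

(* Strong measurability on K (a.e. limit of simple functions) together with
   convergence in mean, along one and the same sequence. *)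
Definition bochner_approx (K : set T) (f : T -> V) (s : nat -> T -> V) : Prop :=
  [/\ forall n, simple_on K (s n),
      {ae mu, forall t, K t -> s n t @[n --> \oo] --> f t} &
      (\int[mu]_(t in K) (rnorm (f t - s n t))%:E)%E @[n --> \oo] --> 0%E].

Definition bochner_integrable (K : set T) (f : T -> V) : Prop :=
  exists s, bochner_approx K f s.

(* The limit does not depend on the approximating sequence. *)
Definition bochner_integral (K : set T) (f : T -> V) : V :=
  xget 0 [set v | exists2 s, bochner_approx K f s &
                             simple_integral K (s n) @[n --> \oo] --> v].

End BochnerIntegral.

(* A topological abelian group (written additively) with its Borel sets. The
   library attaches a generated sigma-algebra only to pointed types. *)
Definition borel (G : topologicalZmodType) : Type := G.

Section Borel.
Variable G : topologicalZmodType.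
HB.instance Definition _ := Choice.on (borel G).
HB.instance Definition _ := isPointed.Build (borel G) (0 : G).
HB.instance Definition _ :=
  @isMeasurable.Build (sigma_display (@open G)) (borel G)
    <<s @open G >> (@sigma_algebra0 (borel G) setT (@open G))
    (@sigma_algebraC (borel G) (@open G))
    (@sigma_algebra_bigcup (borel G) setT (@open G)).
End Borel.

(* Nonzero translation-invariant Radon measure. *)
Definition is_haar (R : realType) (G : topologicalZmodType)
    (mu : {measure set (borel G) -> \bar R}) : Prop :=
  [/\ mu setT != 0%E,
      forall (g : G) (B : set (borel G)), measurable B ->
        mu [set g + t | t in (B : set G)] = mu B,
      forall K : set G, compact K -> (mu K < +oo)%E,
      forall B : set (borel G), measurable B ->
        mu B = ereal_inf [set mu U | U in [set U : set G | open U /\ B `<=` U]] &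
      forall U : set G, open U ->
        mu U = ereal_sup [set mu K | K in [set K : set G | compact K /\ K `<=` U]]].

Section UnconditionalIntegral.
Context {R : realType} {G : topologicalZmodType} {V : completeNormedModType R[i]}.
Variable mu : {measure set (borel G) -> \bar R}.

Definition rcompact (K : set (borel G)) : Prop :=
  measurable K /\ precompact (K : set G).

(* The tail filter of the relatively compact sets directed by inclusion. *)
Definition rcompact_net : set_system (set (borel G)) :=
  filter_from rcompact (fun K => [set L | rcompact L /\ K `<=` L]).

Definition uncond_integrable (f : G -> V) : Prop :=
  (forall K, rcompact K -> bochner_integrable mu K f) /\
  cvg (bochner_integral mu K f @[K --> rcompact_net]).

(* Meaningful when [uncond_integrable f] holds. *)
Definition uncond_integral (f : G -> V) : V :=
  lim (bochner_integral mu K f @[K --> rcompact_net]).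

End UnconditionalIntegral.

(* The Pontryagin dual, with pointwise product and compact-open topology. *)
Section PontryaginDual.
Context (R : realType) (G : topologicalZmodType).

(* [R[i]^o] is R[i] as a normed space over itself. *)
Record pontryagin_dual := Dual {
  duality :> G -> R[i]^o;
  duality_continuous : continuous duality;
  duality_norm : forall t, `|duality t| = 1;
  dualityD : forall s t, duality (s + t) = duality s * duality t
}.

HB.instance Definition _ := gen_eqMixin pontryagin_dual.
HB.instance Definition _ := gen_choiceMixin pontryagin_dual.
HB.instance Definition _ := Topological.copy pontryagin_dual
  (initial_topology (duality : pontryagin_dual -> {compact-open, G -> R[i]^o})).

Program Definition dual1 : pontryagin_dual := @Dual (fun=> 1) _ _ _.
Next Obligation.
by move=> x; exact: cvg_cst.
Qed.
Next Obligation.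
by move=> t; rewrite normr1.
Qed.
Next Obligation.
by move=> s t; rewrite mulr1.
Qed.

Program Definition dualM (x y : pontryagin_dual) : pontryagin_dual :=
  @Dual (fun t => x t * y t) _ _ _.
Next Obligation.
by move=> x y t; exact: (cvgM (@duality_continuous x t) (@duality_continuous y t)).
Qed.
Next Obligation.
by move=> x y t; rewrite normrM !duality_norm mulr1.
Qed.
Next Obligation.
by move=> x y s t; rewrite /= !dualityD mulrACA.
Qed.

End PontryaginDual.
Arguments dual1 {R G}.

(* Strongly continuous actions by *-automorphisms; bijectivity of each [act t]
   follows from [act0] and [actD]. *)
Record cstar_action (R : realType) (G : topologicalZmodType)
    (A : cstarAlgType R) := CstarAction {
  act :> G -> A -> A;
  act_linear : forall t, linear (act t);
  actM : forall t a b, act t (a *c b) = act t a *c act t b;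
  act_star : forall t a, act t (star a) = star (act t a);
  act0 : forall a, act 0 a = a;
  actD : forall s t a, act (s + t) a = act s (act t a);
  act_continuous : forall a, continuous (fun t => act t a)
}.

Section FourierCoefficients.
Context {R : realType} {G : topologicalZmodType} {A : cstarAlgType R}.
Variable mu : {measure set (borel G) -> \bar R}.
Variable alpha : cstar_action G A.

Definition action_integrable (a : A) : Prop :=
  forall b : A, uncond_integrable mu (fun t => alpha t a *c b) /\
                uncond_integrable mu (fun t => b *c alpha t a).

(* M(A) acts faithfully on A, so at most one multiplier satisfies the defining
   equations; [xget] selects it, the default [mult0] being irrelevant when [a] is
   [action_integrable]. *)
Definition fourier (x : pontryagin_dual R G) (a : A) : multiplier A :=
  xget mult0 [set m : multiplier A | forall b : A,
    lmult m b = uncond_integral mu (fun t => x t *: (alpha t a *c b)) /\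
    rmult m b = uncond_integral mu (fun t => x t *: (b *c alpha t a))].

(* To be used for [action_integrable] elements [a] and [b]. *)
Definition rel_continuous (a b : A) : Prop :=
  forall eps : R, 0 < eps ->
    \forall z \near (dual1 : pontryagin_dual R G), forall x y : pontryagin_dual R G,
      mult_norm (multB (multM (fourier (dualM x z) a) (fourier y b))
                       (multM (fourier x a) (fourier (dualM z y) b))) < eps.

End FourierCoefficients.

(* Main.v *)
(* Put J_K(x, a) = int_K x(t) alpha_t(a) dt, so that E_x(a) b is the limit of
   J_K(x, a) b along the relatively compact K.  For e = E_y(c) v,
   e' = E_{zy}(c) v and xi(t) = z(t) e - e', the vector
     (E_{xz}(a) E_y(c) - E_x(a) E_{zy}(c)) v
   is the integral of x(t) alpha_t(a) xi(t).  Cauchy-Schwarz and a <= b bound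
   the square of its norm by |E_1(a)| times the norm of the integral of
   xi(t)^* alpha_t(b) xi(t), which is
     e^* (E_{z^-1 z}(b) E_y(c) - E_{z^-1}(b) E_{zy}(c)) v
       - e'^* (E_z(b) E_y(c) - E_1(b) E_{zy}(c)) v.
   Both brackets are small by relative continuity of b and c, and e, e' are
   bounded by |v| uniformly in y.

   Positivity is used only through the monotonicity of the norm on sums of
   elements h^* h.  For self-adjoint u the operator norms of the polynomials in u
   form a seminorm N on R[X] with N(p)^2 <= N(p^2 + q^2); this alone gives
   approximate square roots, and p is called positive when N(l - p) <= l for some
   l.  The positivity of u = h^* h then follows by iterating
   h |-> h - h h^* h, which replaces u by u (1 - u)^2: on [-1, 1] its maximum is
   4/27 and it lies below u on the negative axis, so a lower bound -t for all
   such u improves to -4t/27. *)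

Require Import Defs.
From HB Require Import structures.
From mathcomp Require Import all_boot all_order all_algebra.
From mathcomp Require Import complex.
From mathcomp Require Import all_classical all_reals all_analysis.
From mathcomp Require Import measurable_realfun finmap ring lra.
Import Order.TTheory GRing.Theory Num.Theory.
Import numFieldNormedType.Exports.
Local Open Scope classical_set_scope.
Local Open Scope ring_scope.

Set Implicit Arguments.
Unset Strict Implicit.
Unset Printing Implicit Defensive.

(** * Seminorms on polynomials *)

Section PolySeminorm.
Context {R : realType}.
Variable N : {poly R} -> R.

(** These are the properties that the operator norms of the polynomials in a self-adjoint element
    are shown to have. [seminorm1] is an inequality because this norm vanishes in the zero
    algebra. *)
Record cstar_seminorm : Prop := CstarSeminorm {
  seminormD : forall p q, N (p + q) <= N p + N q;
  seminormM : forall p q, N (p * q) <= N p * N q;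
  seminormC : forall c p, N (c%:P * p) <= `|c| * N p;
  seminorm1 : N 1 <= 1;
  seminorm_sqr : forall p q, N p ^+ 2 <= N (p ^+ 2 + q ^+ 2)
}.

Hypothesis HN : cstar_seminorm.

(** A real function with [|l - p| <= l] is nonnegative, and a nonnegative one satisfies this as soon
    as l bounds it. This expresses positivity by norms alone, without a spectrum. *)
Definition poly_pos (p : {poly R}) : Prop :=
  exists2 l, 0 <= l & N (l%:P - p) <= l.

Lemma seminormN p : N (- p) <= N p.
Proof.
have := seminormC HN (-1) p; rewrite normrN1 mul1r.
by rewrite polyCN polyC1 mulN1r.
Qed.

Lemma seminorm_ge0 p : 0 <= N p.
Proof.
have N0 : 0 <= N 0.
  have := seminorm_sqr HN 0 0; rewrite expr0n addr0; apply: le_trans.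
  exact: sqr_ge0.
have := seminormD HN p (- p); rewrite subrr => h.
have := seminormN p; lra.
Qed.

Lemma seminormB p q : N (p - q) <= N p + N q.
Proof.
by apply: le_trans (seminormD HN _ _) _; rewrite lerD2l seminormN.
Qed.

Lemma seminorm_polyC c : N c%:P <= `|c|.
Proof.
rewrite -[c%:P]mulr1; apply: le_trans (seminormC HN _ _) _.
by rewrite ler_piMr// seminorm1.
Qed.

Lemma seminorm_sqr_le p : N p ^+ 2 <= N (p ^+ 2).
Proof. by have := seminorm_sqr HN p 0; rewrite expr0n addr0. Qed.

(** A fixed point k of this iteration satisfies [(1 - k) ^ 2 = 1 - s]. *)
Fixpoint sqrt_iter (s : {poly R}) n : {poly R} :=
  if n is m.+1 then (2^-1)%:P * (s + sqrt_iter s m ^+ 2) else 0.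

Lemma half_seminorm p : N ((2^-1)%:P * p) <= 2^-1 * N p.
Proof. by have := seminormC HN 2^-1 p; rewrite ger0_norm// invr_ge0. Qed.

Lemma sqrt_iter_bound s r n : N s <= r -> r <= 1 -> N (sqrt_iter s n) <= r.
Proof.
move=> sr r1; have r0 : 0 <= r := le_trans (seminorm_ge0 s) sr.
elim: n => [|n IH] /=.
  by have := seminorm_polyC 0; rewrite polyC0 normr0; lra.
apply: le_trans (half_seminorm _) _.
have h1 := seminormD HN s (sqrt_iter s n ^+ 2).
have h2 : N (sqrt_iter s n ^+ 2) <= r * r.
  rewrite expr2; apply: le_trans (seminormM HN _ _) _.
  by apply: ler_pM => //; exact: seminorm_ge0.
nra.
Qed.

(** One step multiplies the difference u - v of two iterates by (u + v) / 2, whose seminorm is at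
    most r. *)
Lemma sqrt_iter_step s r n : N s <= r -> r <= 1 ->
  N (sqrt_iter s n.+1 - sqrt_iter s n) <= r ^+ n.+1.
Proof.
move=> sr r1; have r0 : 0 <= r := le_trans (seminorm_ge0 s) sr.
elim: n => [|n IH].
  rewrite /= expr0n addr0 subr0 expr1.
  by have := half_seminorm s; have := seminorm_ge0 s; lra.
have hu : N (sqrt_iter s n.+1) <= r by exact: sqrt_iter_bound.
have hv : N (sqrt_iter s n) <= r by exact: sqrt_iter_bound.
have -> : sqrt_iter s n.+2 = (2^-1)%:P * (s + sqrt_iter s n.+1 ^+ 2) by [].
have Eu : sqrt_iter s n.+1 = (2^-1)%:P * (s + sqrt_iter s n ^+ 2) by [].
move: (sqrt_iter s n.+1) (sqrt_iter s n) Eu IH hu hv => u v Eu IH hu hv.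
have -> : (2^-1)%:P * (s + u ^+ 2) - u = (2^-1)%:P * ((u - v) * (u + v)).
  by rewrite [X in _ - X]Eu; ring.
apply: le_trans (half_seminorm _) _.
have h : N ((u - v) * (u + v)) <= r ^+ n.+1 * (r + r).
  apply: le_trans (seminormM HN _ _) _.
  apply: ler_pM => //; try exact: seminorm_ge0.
  apply: le_trans (seminormD HN _ _) _; exact: lerD.
rewrite [r ^+ n.+2]exprSr; lra.
Qed.

(* The approximate root has the form [1 - k] with [k] the limit of
   [k = (s + k ^ 2) / 2]. *)
Lemma approx_sqrt s e : N s < 1 -> 0 < e -> exists q, N (1 - s - q ^+ 2) < e.
Proof.
move=> s1 e0; set r := N s; have r0 : 0 <= r := seminorm_ge0 s.
have rn0 : r ^+ n @[n --> \oo] --> (0 : R) by apply: cvg_expr; rewrite ger0_norm.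
have e20 : 0 < e / 2 by rewrite divr_gt0.
have /cvgrPdist_lt/(_ _ e20) [n _ /(_ n (leqnn n))] := rn0.
rewrite /= sub0r normrN ger0_norm ?exprn_ge0// => rne.
exists (1 - sqrt_iter s n).
(* Up to sign, the defect of the approximate root is twice one increment of the iteration. *)
have -> : 1 - s - (1 - sqrt_iter s n) ^+ 2
   = - (2%:P * (sqrt_iter s n.+1 - sqrt_iter s n)).
  have h2 : (2%:P * (2^-1)%:P : {poly R}) = 1 by rewrite -polyCM divff.
  rewrite /= mulrBr mulrA h2 mul1r.
  have -> : (2%:P : {poly R}) = 1 + 1 by rewrite -[in LHS]natr1 polyCD polyC1.
  by ring.
apply: le_lt_trans (seminormN _) _; apply: le_lt_trans (seminormC HN _ _) _.
have := sqrt_iter_step n (lexx (N s)) (ltW s1); rewrite -/r exprSr.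
have : r ^+ n * r <= r ^+ n by rewrite ler_piMr ?exprn_ge0// ltW.
rewrite ger0_norm; lra.
Qed.

(** Put s = (l - p) / (l + d), of seminorm below 1 because d > 0. Then p + d = (l + d)(1 - s), and
    [approx_sqrt] applies to 1 - s. *)
Lemma poly_pos_approx p : poly_pos p ->
  forall e, 0 < e -> exists q, N (p - q ^+ 2) < e.
Proof.
move=> [l l0 hl] e e0; set d := e / 2.
have d0 : 0 < d by rewrite divr_gt0.
have ld0 : 0 < l + d by lra.
have hs : N ((l + d)^-1%:P * (l%:P - p)) < 1.
  apply: le_lt_trans (seminormC HN _ _) _.
  rewrite gtr0_norm ?invr_gt0// -ltr_pdivlMl ?invr_gt0// invrK mulr1; lra.
have [|q hq] := @approx_sqrt _ (d / (l + d)) hs; first exact: divr_gt0.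
exists ((Num.sqrt (l + d))%:P * q).
have -> : p - ((Num.sqrt (l + d))%:P * q) ^+ 2 =
   (l + d)%:P * (1 - (l + d)^-1%:P * (l%:P - p) - q ^+ 2) - d%:P.
  have hu : (l + d)%:P * ((l + d)^-1%:P * (l%:P - p)) = l%:P - p.
    by rewrite mulrA -polyCM divff ?gt_eqF// mul1r.
  rewrite exprMn -polyC_exp sqr_sqrtr ?ltW//.
  by rewrite [_ * (_ - q ^+ 2)]mulrBr [_ * (1 - _)]mulrBr hu polyCD; ring.
apply: le_lt_trans (seminormB _ _) _.
have := seminorm_polyC d; rewrite gtr0_norm// => hd.
have := seminormC HN (l + d) (1 - (l + d)^-1%:P * (l%:P - p) - q ^+ 2).
rewrite gtr0_norm//.
have : (l + d) * N (1 - (l + d)^-1%:P * (l%:P - p) - q ^+ 2) < d.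
  by rewrite -ltr_pdivlMl// [ltRHS]mulrC.
rewrite /d in hd *; lra.
Qed.

(* [1 - q ^ 2] is close to a square [r ^ 2], and [q ^ 2 + r ^ 2] close to 1
   forces the norm of [r] to be at most about 1. *)
Lemma seminorm_1Bsqr q : N q < 1 -> N (1 - q ^+ 2) <= 1.
Proof.
move=> q1; apply/ler_addgt0Pr => e e0.
have q2 : N (q ^+ 2) < 1.
  rewrite expr2; apply: le_lt_trans (seminormM HN _ _) _.
  have := seminorm_ge0 q; nra.
have e20 : 0 < e / 2 by rewrite divr_gt0.
have [r hr] := approx_sqrt q2 e20.
have h1 := seminorm_sqr HN r q.
have h2 : N (r ^+ 2 + q ^+ 2) <= 1 + N (1 - q ^+ 2 - r ^+ 2).
  have -> : r ^+ 2 + q ^+ 2 = 1 - (1 - q ^+ 2 - r ^+ 2) by ring.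
  by apply: le_trans (seminormB _ _) _; have := seminorm1 HN; lra.
have h3 : N (r ^+ 2) <= N r ^+ 2 by rewrite !expr2; exact: (seminormM HN).
have h4 : N (1 - q ^+ 2) <= N (1 - q ^+ 2 - r ^+ 2) + N (r ^+ 2).
  by apply: le_trans _ (seminormD HN _ _); rewrite subrK.
lra.
Qed.

Lemma seminorm_Bsqr q l : 0 < l -> N q ^+ 2 < l -> N (l%:P - q ^+ 2) <= l.
Proof.
move=> l0 ql; have sl0 : 0 < Num.sqrt l by rewrite sqrtr_gt0.
have h1 : N ((Num.sqrt l)^-1%:P * q) < 1.
  apply: le_lt_trans (seminormC HN _ _) _.
  rewrite gtr0_norm ?invr_gt0// -ltr_pdivlMl ?invr_gt0// invrK mulr1.
  rewrite -(ltr_pXn2r (n := 2)) ?nnegrE ?seminorm_ge0 ?sqrtr_ge0//.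
  by rewrite sqr_sqrtr// ltW.
have := seminorm_1Bsqr h1.
rewrite exprMn -polyC_exp exprVn (sqr_sqrtr (ltW l0)) => h2.
have -> : l%:P - q ^+ 2 = l%:P * (1 - l^-1%:P * q ^+ 2).
  by rewrite mulrBr mulr1 mulrA -polyCM (divff (lt0r_neq0 l0)) mul1r.
apply: le_trans (seminormC HN _ _) _.
by rewrite gtr0_norm// ler_piMr// ltW.
Qed.

(** The C*-inequality bounds N(q)^2 by N(q^2), hence by slightly more than l, and [seminorm_Bsqr]
    applies to q. This frees positivity from the particular l that witnesses it. *)
Lemma approx_pos_bound p l :
  (forall e, 0 < e -> exists q, N (p - q ^+ 2) < e) -> N p <= l ->
  N (l%:P - p) <= l.
Proof.
(* The estimate costs 5 d: two for enlarging l, one for p - q^2, two for returning to l. *)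
move=> h pl; apply/ler_addgt0Pr => e e0; set d := e / 5.
have d0 : 0 < d by rewrite divr_gt0.
have [q hq] := h _ d0.
have l0 := le_trans (seminorm_ge0 p) pl.
have h1 : N q ^+ 2 < l + (d + d).
  apply: le_lt_trans (seminorm_sqr_le _) _.
  have -> : q ^+ 2 = p - (p - q ^+ 2) by ring.
  by apply: le_lt_trans (seminormB _ _) _; lra.
have h2 : N ((l + (d + d))%:P - q ^+ 2) <= l + (d + d).
  by apply: seminorm_Bsqr => //; lra.
have -> : l%:P - p = (l + (d + d))%:P - q ^+ 2 - (p - q ^+ 2) - (d + d)%:P.
  by rewrite !polyCD; ring.
apply: le_trans (seminormB _ _) _.
have h3 := seminormB ((l + (d + d))%:P - q ^+ 2) (p - q ^+ 2).
have := seminorm_polyC (d + d); rewrite ger0_norm; last by lra.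
rewrite /d in hq h2 h3 *; lra.
Qed.

Lemma poly_posP p :
  poly_pos p <-> forall e, 0 < e -> exists q, N (p - q ^+ 2) < e.
Proof.
split; first exact: poly_pos_approx.
by move=> h; exists (N p); [exact: seminorm_ge0 | exact: approx_pos_bound].
Qed.

Lemma poly_pos_bound p l : poly_pos p -> N p <= l -> N (l%:P - p) <= l.
Proof. by move=> /poly_posP; exact: approx_pos_bound. Qed.

Lemma poly_pos_sqr q : poly_pos (q ^+ 2).
Proof.
apply/poly_posP => e e0; exists q; rewrite subrr.
by have := seminorm_polyC 0; rewrite polyC0 normr0; lra.
Qed.

Lemma poly_posD p q : poly_pos p -> poly_pos q -> poly_pos (p + q).
Proof.
move=> [l l0 hl] [m m0 hm]; exists (l + m); first exact: addr_ge0.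
have -> : (l + m)%:P - (p + q) = (l%:P - p) + (m%:P - q) by rewrite polyCD; ring.
by apply: le_trans (seminormD HN _ _) _; exact: lerD.
Qed.

(** Polynomials commute, so the product of the approximating squares r^2 and t^2 is the square of r
    t. The precision of t depends on the r already chosen. *)
Lemma poly_posM p q : poly_pos p -> poly_pos q -> poly_pos (p * q).
Proof.
move=> hp hq; apply/poly_posP => e e0.
have q0 := seminorm_ge0 q.
have [|r hr] := poly_pos_approx hp (e:=e / 2 / (N q + 1)).
  by rewrite !divr_gt0//; lra.
have r0 := seminorm_ge0 (r ^+ 2).
have [|t ht] := poly_pos_approx hq (e:=e / 2 / (N (r ^+ 2) + 1)).
  by rewrite !divr_gt0//; lra.
exists (r * t).
have -> : p * q - (r * t) ^+ 2 = (p - r ^+ 2) * q + r ^+ 2 * (q - t ^+ 2).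
  by ring.
apply: le_lt_trans (seminormD HN _ _) _.
have h1 := seminormM HN (p - r ^+ 2) q.
have h2 := seminormM HN (r ^+ 2) (q - t ^+ 2).
have h3 : N (p - r ^+ 2) * (N q + 1) < e / 2 by rewrite -ltr_pdivlMr//; lra.
have h4 : N (q - t ^+ 2) * (N (r ^+ 2) + 1) < e / 2 by rewrite -ltr_pdivlMr//; lra.
have := seminorm_ge0 (p - r ^+ 2); have := seminorm_ge0 (q - t ^+ 2).
lra.
Qed.

Lemma poly_pos_CB p l : N p <= l -> poly_pos (l%:P - p).
Proof.
move=> h; exists l; first exact: le_trans (seminorm_ge0 p) h.
by rewrite opprB addrC subrK.
Qed.

Lemma poly_pos_CD p l : N p <= l -> poly_pos (l%:P + p).
Proof.
by move=> h; rewrite -[p]opprK; apply/poly_pos_CB/le_trans/h/seminormN.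
Qed.

Lemma poly_posC c : 0 <= c -> poly_pos c%:P.
Proof.
move=> c0; exists c => //; rewrite subrr.
by have := seminorm_polyC 0; rewrite polyC0 normr0; lra.
Qed.

(** With p close to r^2 and l - p close to t^2, the sum r^2 + t^2 is close to l, and the
    C*-inequality bounds N(r)^2 by its seminorm. *)
Lemma poly_pos_norm p l : 0 <= l -> poly_pos p -> poly_pos (l%:P - p) -> N p <= l.
Proof.
move=> l0 /poly_posP hp /poly_posP hq; apply/ler_addgt0Pr => e e0.
have d0 : 0 < e / 3 by rewrite divr_gt0.
have [r hr] := hp _ d0; have [t ht] := hq _ d0.
have h1 := seminorm_sqr HN r t.
have h2 : N (r ^+ 2 + t ^+ 2) < l + (e / 3 + e / 3).
  have -> : r ^+ 2 + t ^+ 2 = l%:P - (p - r ^+ 2) - (l%:P - p - t ^+ 2) by ring.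
  apply: le_lt_trans (seminormB _ _) _.
  have := seminormB l%:P (p - r ^+ 2).
  by have := seminorm_polyC l; rewrite ger0_norm//; lra.
have h3 : N (r ^+ 2) <= N r ^+ 2 by rewrite !expr2; exact: (seminormM HN).
have h4 : N p <= N (p - r ^+ 2) + N (r ^+ 2).
  by apply: le_trans _ (seminormD HN _ _); rewrite subrK.
lra.
Qed.

End PolySeminorm.

(** * Positive elements of a C*-algebra *)

Section RealNorm.
Context {R : realType} {V : normedModType R[i]}.
Implicit Types v w : V.

Lemma rnormE v : `|v| = ((rnorm v)%:C)%C.
Proof. by rewrite /rnorm RRe_real// ger0_real. Qed.

Lemma rnorm_ge0 v : 0 <= rnorm v.
Proof. by have := normr_ge0 v; rewrite rnormE lecR. Qed.

Lemma rnormD v w : rnorm (v + w) <= rnorm v + rnorm w.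
Proof. by have := ler_normD v w; rewrite !rnormE -rmorphD lecR. Qed.

Lemma rnormZ k v : rnorm (k *: v) = complex.Re `|k| * rnorm v.
Proof.
have := normrZ k v; rewrite !rnormE => h; apply: complexI.
by rewrite h rmorphM/= [X in X * _](RRe_real (normr_real k)).
Qed.

Lemma rnormZR (c : R) v : rnorm ((c%:C)%C *: v) = `|c| * rnorm v.
Proof. by rewrite rnormZ normc_def/= expr0n addr0 sqrtr_sqr. Qed.

Lemma rnormN v : rnorm (- v) = rnorm v.
Proof. by rewrite /rnorm normrN. Qed.

Lemma rnormB v w : rnorm (v - w) <= rnorm v + rnorm w.
Proof. by rewrite -(rnormN w); exact: rnormD. Qed.

Lemma rnormBC v w : rnorm (v - w) = rnorm (w - v).
Proof. by rewrite -opprB rnormN. Qed.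

Lemma rnorm0 : rnorm (0 : V) = 0.
Proof. by rewrite /rnorm normr0. Qed.

Lemma rnorm_sum (I : Type) (r : seq I) (P : pred I) (F : I -> V) :
  rnorm (\sum_(i <- r | P i) F i) <= \sum_(i <- r | P i) rnorm (F i).
Proof.
elim/big_rec2 : _ => [|i y x _ h]; first by rewrite rnorm0.
by apply: le_trans (rnormD _ _) _; rewrite lerD2l.
Qed.

Lemma scaleCM (c d : R) v : ((c * d)%:C)%C *: v = (c%:C)%C *: ((d%:C)%C *: v).
Proof. by rewrite rmorphM scalerA. Qed.

Lemma scaleCD (c d : R) v : ((c + d)%:C)%C *: v = (c%:C)%C *: v + (d%:C)%C *: v.
Proof. by rewrite rmorphD scalerDl. Qed.

End RealNorm.

Section CstarNorm.
Context {R : realType} {A : cstarAlgType R}.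
Implicit Types a b c u v : A.

Lemma rnorm_cmul a b : rnorm (a *c b) <= rnorm a * rnorm b.
Proof. by have := cmul_norm a b; rewrite !rnormE -rmorphM lecR. Qed.

Lemma rnorm_cstar a : rnorm (star a *c a) = rnorm a ^+ 2.
Proof.
have := cstar_identity a; rewrite !rnormE -rmorphXn/= => h.
exact: complexI.
Qed.

Lemma rnorm_star a : rnorm (star a) = rnorm a.
Proof.
suff h b : rnorm b <= rnorm (star b).
  by apply/eqP; rewrite eq_le h -{2}[a]starK h.
have := rnorm_cmul (star b) b; rewrite rnorm_cstar expr2.
have := rnorm_ge0 b; rewrite le_eqVlt => /predU1P[<- _|b0]; first exact: rnorm_ge0.
by rewrite ler_pM2r.
Qed.

Lemma star_scale (k : R[i]) a : star (k *: a) = conjc k *: star a.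
Proof. exact: starZ. Qed.

Lemma star0 : star (0 : A) = 0.
Proof. by rewrite -[0 in LHS](scale0r 0) star_scale conjc0 scale0r. Qed.

Lemma starN a : star (- a) = - star a.
Proof. by rewrite -scaleN1r star_scale rmorphN1 scaleN1r. Qed.

Lemma starB a b : star (a - b) = star a - star b.
Proof. by rewrite starD starN. Qed.

Lemma starZR (c : R) a : star ((c%:C)%C *: a) = (c%:C)%C *: star a.
Proof. by rewrite star_scale conjc_real. Qed.

Lemma cmul_suml (I : Type) (r : seq I) (F : I -> A) b :
  (\sum_(i <- r) F i) *c b = \sum_(i <- r) (F i *c b).
Proof.
by elim/big_rec2 : _ => [|i y x _ <-]; rewrite ?cmul0l ?cmulDl.
Qed.

Lemma cmul_sumr (I : Type) (r : seq I) (F : I -> A) b :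
  b *c (\sum_(i <- r) F i) = \sum_(i <- r) (b *c F i).
Proof.
by elim/big_rec2 : _ => [|i y x _ <-]; rewrite ?cmul0r ?cmulDr.
Qed.

Lemma star_sum (I : Type) (r : seq I) (F : I -> A) :
  star (\sum_(i <- r) F i) = \sum_(i <- r) star (F i).
Proof.
by elim/big_rec2 : _ => [|i y x _ <-]; rewrite ?star0 ?starD.
Qed.

Definition opnorm (f : A -> A) : R :=
  sup [set rnorm (f b) | b in [set b : A | rnorm b <= 1]].

Lemma opnorm_le (f : A -> A) M :
  0 <= M -> (forall b, rnorm (f b) <= M * rnorm b) -> opnorm f <= M.
Proof.
move=> M0 h; apply: ge_sup.
  by exists (rnorm (f 0)); exists 0 => //=; rewrite rnorm0.
move=> _ [b /= b1 <-]; apply: le_trans (h b) _.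
by rewrite ler_piMr.
Qed.

(** The bound M makes the set defining [opnorm] bounded above, so that its [sup] is a true supremum;
    homogeneity reduces to the unit ball. *)
Lemma le_opnorm (f : A -> A) M :
  (forall (k : R) b, f ((k%:C)%C *: b) = (k%:C)%C *: f b) ->
  (forall b, rnorm (f b) <= M * rnorm b) ->
  forall b, rnorm (f b) <= opnorm f * rnorm b.
Proof.
move=> hZ hM b.
have [b0|b0] := eqVneq (rnorm b) 0.
  by have := hM b; rewrite b0 !mulr0.
have b0' : 0 < rnorm b by rewrite lt0r b0 rnorm_ge0.
rewrite -ler_pdivrMr// mulrC -[X in X * _]gtr0_norm ?invr_gt0//.
rewrite -rnormZR -hZ; apply: ub_le_sup; last first.
  by exists (((rnorm b)^-1%:C)%C *: b) => //=; rewrite rnormZR gtr0_norm ?invr_gt0// mulVf.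
exists `|M| => _ [c /= c1 <-]; apply: le_trans (hM c) _.
apply: le_trans (_ : `|M| * rnorm c <= _); last by rewrite ler_piMr.
by rewrite ler_wpM2r ?rnorm_ge0// ler_norm.
Qed.

Lemma opnorm_ge0 (f : A -> A) M :
  (forall (k : R) b, f ((k%:C)%C *: b) = (k%:C)%C *: f b) ->
  (forall b, rnorm (f b) <= M * rnorm b) -> 0 <= opnorm f.
Proof.
move=> hZ hM; apply: le_trans (rnorm_ge0 (f 0)) _.
apply: ub_le_sup; last by exists 0 => //=; rewrite rnorm0.
exists `|M| => _ [c /= c1 <-]; apply: le_trans (hM c) _.
apply: le_trans (_ : `|M| * rnorm c <= _); last by rewrite ler_piMr.
by rewrite ler_wpM2r ?rnorm_ge0// ler_norm.
Qed.

(** * Polynomials in an element, acting on a possibly non-unital algebra *)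

Section PolyAction.
Variable u : A.

(** Left multiplication by p(u), by Horner's rule. As an operator it makes sense of the constant
    term even when A has no unit. *)
Definition poly_act (p : {poly R}) (b : A) : A :=
  foldr (fun (c : R) v => (c%:C)%C *: b + u *c v) 0 p.

Lemma poly_act0 b : poly_act 0 b = 0.
Proof. by rewrite /poly_act polyseq0. Qed.

Lemma poly_act_cons p (c : R) b :
  poly_act (p * 'X + c%:P) b = (c%:C)%C *: b + u *c poly_act p b.
Proof.
rewrite -cons_poly_def /poly_act polyseq_cons.
case: nilP => [->|//]; rewrite /= cmul0r addr0 polyseqC.
by case: eqP => [->|_]; rewrite /= ?scale0r// cmul0r addr0.
Qed.

Lemma poly_actC (c : R) b : poly_act c%:P b = (c%:C)%C *: b.
Proof.
by have := poly_act_cons 0 c b; rewrite mul0r add0r poly_act0 cmul0r addr0.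
Qed.

Lemma poly_act1 b : poly_act 1 b = b.
Proof. by rewrite -polyC1 poly_actC scale1r. Qed.

Lemma poly_actMX p b : poly_act (p * 'X) b = u *c poly_act p b.
Proof.
by have := poly_act_cons p 0 b; rewrite polyC0 addr0 scale0r add0r.
Qed.

Lemma poly_actX b : poly_act 'X b = u *c b.
Proof. by rewrite -['X]mul1r poly_actMX poly_act1. Qed.

Lemma poly_actD p q b : poly_act (p + q) b = poly_act p b + poly_act q b.
Proof.
elim/poly_ind : p q => [|p c IH] q; first by rewrite poly_act0 !add0r.
elim/poly_ind : q => [|q d _]; first by rewrite poly_act0 !addr0.
have -> : p * 'X + c%:P + (q * 'X + d%:P) = (p + q) * 'X + (c + d)%:P.
  by rewrite polyCD mulrDl addrACA.
by rewrite !poly_act_cons IH cmulDr scaleCD addrACA.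
Qed.

Lemma poly_actCM (c : R) p b : poly_act (c%:P * p) b = (c%:C)%C *: poly_act p b.
Proof.
elim/poly_ind : p => [|p d IH]; first by rewrite mulr0 poly_act0 scaler0.
rewrite mulrDr mulrA -polyCM !poly_act_cons IH scalerDr cmulZr.
by rewrite scaleCM.
Qed.

Lemma poly_actN p b : poly_act (- p) b = - poly_act p b.
Proof. by rewrite -mulN1r -polyC1 -polyCN poly_actCM rmorphN1 scaleN1r. Qed.

Lemma poly_actB p q b : poly_act (p - q) b = poly_act p b - poly_act q b.
Proof. by rewrite poly_actD poly_actN. Qed.

Lemma poly_actM p q b : poly_act (p * q) b = poly_act p (poly_act q b).
Proof.
elim/poly_ind : p => [|p c IH]; first by rewrite mul0r !poly_act0.
have -> : (p * 'X + c%:P) * q = p * q * 'X + c%:P * q by ring.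
by rewrite poly_actD poly_actMX poly_actCM IH poly_act_cons addrC.
Qed.

Lemma poly_actXr p b : poly_act p (u *c b) = u *c poly_act p b.
Proof. by rewrite -[u *c b]poly_actX -poly_actM poly_actMX. Qed.

Lemma poly_actDr p b c : poly_act p (b + c) = poly_act p b + poly_act p c.
Proof.
elim/poly_ind : p => [|p d IH]; first by rewrite !poly_act0 addr0.
by rewrite !poly_act_cons IH scalerDr cmulDr addrACA.
Qed.

Lemma poly_actZr p (k : R[i]) b : poly_act p (k *: b) = k *: poly_act p b.
Proof.
elim/poly_ind : p => [|p d IH]; first by rewrite !poly_act0 scaler0.
by rewrite !poly_act_cons IH scalerDr cmulZr !scalerA mulrC.
Qed.

Lemma poly_act_bounded p :
  exists M, forall b, rnorm (poly_act p b) <= M * rnorm b.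
Proof.
elim/poly_ind : p => [|p c [M IH]].
  by exists 0 => b; rewrite poly_act0 rnorm0 mul0r.
exists (`|c| + rnorm u * M) => b; rewrite poly_act_cons.
apply: le_trans (rnormD _ _) _; rewrite rnormZR mulrDl lerD2l.
apply: le_trans (rnorm_cmul _ _) _; rewrite -mulrA.
by rewrite ler_wpM2l ?rnorm_ge0.
Qed.

Definition poly_norm (p : {poly R}) : R := opnorm (poly_act p).

Lemma le_poly_norm p b : rnorm (poly_act p b) <= poly_norm p * rnorm b.
Proof.
have [M hM] := poly_act_bounded p.
by apply: le_opnorm hM _ => k c; exact: poly_actZr.
Qed.

Lemma poly_norm_ge0 p : 0 <= poly_norm p.
Proof.
have [M hM] := poly_act_bounded p.
by apply: opnorm_ge0 hM => k c; exact: poly_actZr.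
Qed.

Lemma poly_norm_le p M : 0 <= M ->
  (forall b, rnorm (poly_act p b) <= M * rnorm b) -> poly_norm p <= M.
Proof. exact: opnorm_le. Qed.

Hypothesis u_sa : star u = u.

(** Real coefficients and a self-adjoint u make the operator p(u) symmetric. *)
Lemma star_poly_act p b c : star (poly_act p b) *c c = star b *c poly_act p c.
Proof.
elim/poly_ind : p c => [|p d IH] c.
  by rewrite !poly_act0 star0 cmul0l cmul0r.
rewrite !poly_act_cons starD starZR starM u_sa cmulDl cmulZl -cmulA IH.
by rewrite poly_actXr cmulDr cmulZr.
Qed.

(* [p +- i q] satisfy the C*-identity with [(p + i q)* (p + i q) = p ^ 2 + q ^ 2],
   and [p] is their mean. *)
Lemma poly_norm_sqr p q : poly_norm p ^+ 2 <= poly_norm (p ^+ 2 + q ^+ 2).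
Proof.
set M := poly_norm (p ^+ 2 + q ^+ 2); have M0 : 0 <= M := poly_norm_ge0 _.
have h (s : R[i]) b : conjc s = - s -> s * s = -1 ->
    rnorm (poly_act p b + s *: poly_act q b) <= Num.sqrt M * rnorm b.
  move=> sJ s2.
  rewrite -(ler_pXn2r (n := 2)) ?nnegrE ?mulr_ge0 ?sqrtr_ge0 ?rnorm_ge0//.
  rewrite -rnorm_cstar exprMn sqr_sqrtr//.
  have -> : star (poly_act p b + s *: poly_act q b) *c
     (poly_act p b + s *: poly_act q b) = star b *c poly_act (p ^+ 2 + q ^+ 2) b.
    rewrite starD star_scale sJ cmulDl cmulZl !star_poly_act.
    rewrite !poly_actDr !poly_actZr !cmulDr !cmulZr scalerDr scalerA.
    rewrite mulNr s2 opprK scale1r -!poly_actM [q * p]mulrC !expr2 poly_actD.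
    by rewrite cmulDr scaleNr addrA addrK.
  apply: le_trans (rnorm_cmul _ _) _; rewrite rnorm_star expr2 mulrA.
  by rewrite [_ * rnorm b]mulrC ler_wpM2l ?rnorm_ge0// le_poly_norm.
rewrite -[leRHS](sqr_sqrtr M0) ler_pXn2r ?nnegrE ?poly_norm_ge0 ?sqrtr_ge0//.
apply: poly_norm_le (sqrtr_ge0 _) _ => b.
have hi := h ('i)%C b; have hni := h (- 'i)%C b.
have -> : poly_act p b = ((2^-1)%:C)%C *: ((poly_act p b + ('i)%C *: poly_act q b)
   + (poly_act p b + (- 'i)%C *: poly_act q b)).
  rewrite scaleNr addrACA subrr addr0 scalerDr -scaleCD.
  by have -> : 2^-1 + 2^-1 = 1 :> R; [lra | rewrite scale1r].
rewrite rnormZR ger0_norm ?invr_ge0//.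
have := rnormD (poly_act p b + ('i)%C *: poly_act q b) (poly_act p b + (- 'i)%C *: poly_act q b).
have iJ : conjc ('i)%C = (- 'i)%C :> R[i] by apply/eqP; rewrite eq_complex/= oppr0 !eqxx.
have i2 : ('i)%C * ('i)%C = -1 :> R[i] by rewrite -expr2 sqr_i.
have {}hi := hi iJ i2; have {}hni : rnorm (poly_act p b + (- 'i)%C *: poly_act q b)
    <= Num.sqrt M * rnorm b.
  apply: hni; last by rewrite mulrNN.
  by apply/eqP; rewrite eq_complex/= !oppr0 !eqxx.
lra.
Qed.

Lemma poly_norm_seminorm : cstar_seminorm poly_norm.
Proof.
split.
- move=> p q; apply: poly_norm_le => [|b]; first by rewrite addr_ge0 ?poly_norm_ge0.
  rewrite poly_actD mulrDl; apply: le_trans (rnormD _ _) _.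
  by rewrite lerD ?le_poly_norm.
- move=> p q; apply: poly_norm_le => [|b]; first by rewrite mulr_ge0 ?poly_norm_ge0.
  rewrite poly_actM; apply: le_trans (le_poly_norm _ _) _; rewrite -mulrA.
  by rewrite ler_wpM2l ?poly_norm_ge0 ?le_poly_norm.
- move=> c p; apply: poly_norm_le => [|b]; first by rewrite mulr_ge0 ?poly_norm_ge0.
  by rewrite poly_actCM rnormZR -mulrA ler_wpM2l// le_poly_norm.
- by apply: poly_norm_le => // b; rewrite poly_act1 mul1r.
- exact: poly_norm_sqr.
Qed.

(** The norm is attained on u itself, since u u = [star u *c u] has norm |u|^2. *)
Lemma poly_normX : poly_norm 'X = rnorm u.
Proof.
apply/eqP; rewrite eq_le; apply/andP; split.
  apply: poly_norm_le (rnorm_ge0 _) _ => b; rewrite poly_actX.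
  exact: rnorm_cmul.
have [->|u_neq0] := eqVneq (rnorm u) 0; first exact: poly_norm_ge0.
have := le_poly_norm 'X u; rewrite poly_actX -{1}u_sa rnorm_cstar expr2.
by rewrite ler_pM2r// lt0r u_neq0 rnorm_ge0.
Qed.

End PolyAction.
End CstarNorm.

Local Notation "c *r v" := ((c%:C)%C *: v) (at level 40, left associativity).

(** * Positive operators and positive elements *)

Section Positivity.
Context {R : realType} {A : cstarAlgType R}.
Implicit Types a b h u v w : A.

(** The criterion of [poly_pos] for arbitrary operators. Sums of non-commuting elements are handled
    here, products only among polynomials in one element. *)
Definition op_pos (f : A -> A) : Prop :=
  exists2 l : R, 0 <= l & forall b, rnorm (l *r b - f b) <= l * rnorm b.

Definition nonneg v : Prop := star v = v /\ op_pos (cmul v).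

Lemma op_pos_ext (f g : A -> A) : f =1 g -> op_pos f -> op_pos g.
Proof. by move=> fg [l l0 h]; exists l => // b; rewrite -fg. Qed.

Lemma op_posD (f g : A -> A) :
  op_pos f -> op_pos g ->
  op_pos (fun b => f b + g b).
Proof.
move=> [l l0 hl] [m m0 hm]; exists (l + m) => [|b]; first exact: addr_ge0.
rewrite scaleCD opprD addrACA mulrDl; apply: le_trans (rnormD _ _) _.
exact: lerD.
Qed.

Lemma op_posZ (c : R) (f : A -> A) :
  0 <= c -> op_pos f -> op_pos (fun b => c *r f b).
Proof.
move=> c0 [l l0 hl]; exists (c * l) => [|b]; first exact: mulr_ge0.
by rewrite scaleCM -scalerBr rnormZR ger0_norm// -mulrA ler_wpM2l.
Qed.

Lemma op_posE u (p : {poly R}) :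
  op_pos (poly_act u p) <-> poly_pos (poly_norm u) p.
Proof.
split=> -[l l0 hl]; exists l => //.
  by apply: poly_norm_le => // b; rewrite poly_actB poly_actC.
move=> b; rewrite -(poly_actC u) -poly_actB; apply: le_trans (le_poly_norm _ _ _) _.
by rewrite ler_wpM2r ?rnorm_ge0.
Qed.

Lemma op_posX u : op_pos (cmul u) <-> poly_pos (poly_norm u) 'X.
Proof.
by rewrite -op_posE; split; apply: op_pos_ext => b; rewrite poly_actX.
Qed.

Lemma nonnegD u v : nonneg u -> nonneg v -> nonneg (u + v).
Proof.
move=> [hu pu] [hv pv]; split; first by rewrite starD hu hv.
by apply: op_pos_ext (op_posD pu pv) => b; rewrite cmulDl.
Qed.

Lemma nonnegZ (c : R) u : 0 <= c -> nonneg u -> nonneg (c *r u).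
Proof.
move=> c0 [hu pu]; split; first by rewrite starZR hu.
by apply: op_pos_ext (op_posZ c0 pu) => b; rewrite cmulZl.
Qed.

Lemma nonneg0 : nonneg 0.
Proof.
split; first exact: star0.
by exists 0 => // b; rewrite cmul0l subr0 scale0r rnorm0 mul0r.
Qed.

Lemma nonneg_sum (I : Type) (r : seq I) (P : pred I) (F : I -> A) :
  (forall i, P i -> nonneg (F i)) -> nonneg (\sum_(i <- r | P i) F i).
Proof.
by move=> h; elim/big_ind : _ => //; [exact: nonneg0 | exact: nonnegD].
Qed.

Lemma nonneg_sqr h : star h = h -> nonneg (h *c h).
Proof.
move=> hh; split; first by rewrite starM hh.
have /op_posE := poly_pos_sqr (poly_norm_seminorm hh) 'X.
by apply: op_pos_ext => b; rewrite expr2 poly_actMX poly_actX cmulA.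
Qed.

(** If l witnesses the positivity of v, then l + u = (u + v) + (l - v) has norm at most |u + v| + l.
    So |u + v| + l witnesses the positivity of |u + v| - u, a polynomial in u alone, and
    [poly_pos_norm] concludes. *)
Lemma nonneg_norm_le u v : nonneg u -> nonneg v -> rnorm u <= rnorm (u + v).
Proof.
move=> [hu /op_posX pu] [hv [l l0 hl]].
have HN := poly_norm_seminorm hu.
rewrite -(poly_normX hu); apply: poly_pos_norm (rnorm_ge0 _) pu _ => //.
exists (rnorm (u + v) + l); first by rewrite addr_ge0// rnorm_ge0.
apply: poly_norm_le => [|b]; first by rewrite addr_ge0// rnorm_ge0.
have -> : (rnorm (u + v) + l)%:P - ((rnorm (u + v))%:P - 'X) = l%:P + 'X :> {poly R}.
  by rewrite polyCD; ring.
rewrite poly_actD poly_actC poly_actX.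
have -> : l *r b + u *c b = (u + v) *c b + (l *r b - v *c b).
  by rewrite cmulDl addrACA subrr addr0 addrC.
apply: le_trans (rnormD _ _) _; rewrite mulrDl.
by apply: lerD (hl b); exact: rnorm_cmul.
Qed.

(* [w* w + w w* = 2 (Re w) ^ 2 + 2 (Im w) ^ 2] *)
Lemma nonneg_star_mulD w : nonneg (star w *c w + w *c star w).
Proof.
set x := w + star w; set y := ('i)%C *: (w - star w).
have iJ : conjc ('i)%C = (- 'i)%C :> R[i] by apply/eqP; rewrite eq_complex/= oppr0 !eqxx.
have i2 : ('i)%C * ('i)%C = -1 :> R[i] by rewrite -expr2 sqr_i.
have hx : star x = x by rewrite starD starK addrC.
have hy : star y = y.
  by rewrite star_scale iJ starB starK scaleNr -scalerN opprB.
have -> : star w *c w + w *c star w = 2^-1 *r (x *c x + y *c y).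
  rewrite cmulZl cmulZr scalerA i2 scaleN1r.
  set p := w *c w; set q := w *c star w; set r := star w *c w.
  set t := star w *c star w.
  have -> : x *c x = p + q + (r + t) by rewrite cmulDl !cmulDr.
  have -> : (w - star w) *c (w - star w) = p - q - (r - t).
    by rewrite cmulBl !cmulBr.
  have -> : p + q + (r + t) - (p - q - (r - t)) = (r + q) + (r + q).
    rewrite !opprB (AC (2*2*(2*2)) ((3*2)*(5*7)*(1*8)*(4*6))).
    by rewrite /= !subrr !addr0.
  rewrite scalerDr -scaleCD.
  by have -> : 2^-1 + 2^-1 = 1 :> R; [lra | rewrite scale1r].
by apply: nonnegZ; [rewrite invr_ge0 | apply: nonnegD; exact: nonneg_sqr].
Qed.

End Positivity.

(** * Positivity of the elements [star h *c h] *)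

Section Kaplansky.
Context {R : realType} {A : cstarAlgType R}.
Implicit Types a b h u v w : A.

Let S : R := 4 / 27.

Let cubic : {poly R} := 'X * (1 - 'X) ^+ 2.

Lemma poly_pos_lim u (p : {poly R}) : star u = u ->
  (forall e, 0 < e -> poly_pos (poly_norm u) (e%:P + p)) ->
  poly_pos (poly_norm u) p.
Proof.
move=> hu h; have HN := poly_norm_seminorm hu.
apply/(poly_posP HN) => e e0; have e20 : 0 < e / 2 by rewrite divr_gt0.
have [q hq] := poly_pos_approx HN (h _ e20) e20.
exists q; have -> : p - q ^+ 2 = (e / 2)%:P + p - q ^+ 2 - (e / 2)%:P by ring.
apply: le_lt_trans (seminormB HN _ _) _.
by have := seminorm_polyC HN (e / 2); rewrite gtr0_norm//; lra.
Qed.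

(** Formally w = h (1 - u), so [star w *c w] is (1 - u) u (1 - u). *)
Lemma cubic_act h b : let u := star h *c h in let w := h - h *c u in
  star w *c w *c b = poly_act u cubic b.
Proof.
move=> u w; have hu : star u = u by rewrite starM starK.
have -> : cubic = 'X - 2%:P * 'X ^+ 2 + 'X ^+ 3.
  have -> : 2%:P = 1 + 1 :> {poly R} by rewrite -[in LHS]natr1 polyCD polyC1.
  by rewrite /cubic; ring.
rewrite poly_actD poly_actB poly_actCM !exprSr expr0 mul1r !poly_actMX poly_actX.
rewrite /w starB starM hu cmulBl !cmulBr !cmulBl.
have -> : star h *c h = u by [].
have -> : star h *c (h *c u) = u *c u by rewrite cmulA.
have -> : u *c star h *c h = u *c u by rewrite -cmulA.
have -> : u *c star h *c (h *c u) = u *c u *c u.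
  by rewrite -[u *c star h *c _]cmulA [star h *c _]cmulA cmulA.
by rewrite scaleCD scale1r !cmulA opprB opprD !addrA (addrAC _ _ (- _)).
Qed.

(* On the spectrum of [h* h], contained in [-1, 1], the function
   [x (1 - x) ^ 2] is at most 4/27.  A value of [w* w] below -4/27 is excluded
   because [w w*], which has the same spectrum up to 0, is the difference of the
   positive [w* w + w w*] and of [w* w]. *)
Lemma kaplansky_norm h : rnorm h <= 1 ->
  rnorm (h - h *c (star h *c h)) ^+ 2 <= S.
Proof.
move=> h1; set u := star h *c h; set w := h - h *c u; have hu : star u = u by rewrite starM starK.
have HN := poly_norm_seminorm hu.
have S0 : 0 <= S by rewrite divr_ge0.
have u1 : rnorm u <= 1.
  by rewrite rnorm_cstar expr_le1 ?rnorm_ge0.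
set y := star w *c w; set y' := w *c star w; set nu := rnorm w ^+ 2.
have hy : star y = y by rewrite starM starK.
have hy' : star y' = y' by rewrite starM starK.
have nu0 : 0 <= nu by exact: sqr_ge0.
have ny : rnorm y = nu by rewrite rnorm_cstar.
have ny' : rnorm y' = nu by rewrite /y' -{1}[w]starK rnorm_cstar rnorm_star.
have p1 : poly_pos (poly_norm u) (S%:P - cubic).
  pose t := (3^-1)%:P : {poly R}.
  have h1t : 1 = t + t + t by rewrite -polyC1 -!polyCD; congr _%:P; lra.
  have h4t : (4 / 3)%:P = t + t + t + t by rewrite -!polyCD; congr _%:P; lra.
  have hS : S%:P = t * t * t + t * t * t + t * t * t + t * t * t.
    by rewrite -!polyCM -!polyCD; congr _%:P; rewrite /S; lra.
  (* The cubic has its local maximum 4/27 at t = 1/3, which is therefore a double root of the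
     difference; the other factor is positive because |u| <= 1. *)
  have -> : S%:P - cubic = ('X - t) ^+ 2 * ((4 / 3)%:P - 'X).
    by rewrite hS h4t /cubic h1t; ring.
  apply: (poly_posM HN); first exact: poly_pos_sqr.
  by apply: (poly_pos_CB HN); rewrite poly_normX//; lra.
have p1' : op_pos (fun b => S *r b - y *c b).
  have /op_posE := p1; apply: op_pos_ext => b.
  by rewrite poly_actB poly_actC cubic_act.
(* S + y' is the sum of the positive S - y and y + y'. *)
have p2 : poly_pos (poly_norm y') (S%:P + 'X).
  apply/op_posE; have [_ p3] := nonneg_star_mulD w.
  apply: op_pos_ext (op_posD p1' p3) => b.
  by rewrite poly_actD poly_actC poly_actX cmulDl addrA subrK.
have HN' := poly_norm_seminorm hy'; have HNy := poly_norm_seminorm hy.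
(* S + y' is positive of norm at most S + nu, hence so bounded is its difference from S + nu, which
   is nu - y'. *)
have b2 b : rnorm (nu *r b - y' *c b) <= (S + nu) * rnorm b.
  have hS : poly_norm y' (S%:P + 'X) <= S + nu.
    apply: le_trans (seminormD HN' _ _) _; rewrite poly_normX// ny' lerD2r.
    by have := seminorm_polyC HN' S; rewrite ger0_norm.
  have := le_poly_norm y' ((S + nu)%:P - (S%:P + 'X)) b.
  have -> : (S + nu)%:P - (S%:P + 'X) = nu%:P - 'X by rewrite polyCD; ring.
  rewrite poly_actB poly_actC poly_actX => /le_trans; apply.
  rewrite ler_wpM2r ?rnorm_ge0//.
  have := poly_pos_bound HN' p2 hS.
  by have -> : (S + nu)%:P - (S%:P + 'X) = nu%:P - 'X by rewrite polyCD; ring.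
(* The bound passes from y' to y through y (nu - y) = [star w] (nu - y') w. *)
have b3 : poly_norm y (nu%:P * 'X - 'X ^+ 2) <= nu * (S + nu).
  apply: poly_norm_le => [|b]; first by rewrite mulr_ge0// addr_ge0.
  rewrite poly_actB poly_actCM expr2 poly_actMX !poly_actX.
  have -> : nu *r (y *c b) - y *c (y *c b) =
            star w *c (nu *r (w *c b) - y' *c (w *c b)).
    by rewrite cmulBr cmulZr !cmulA.
  apply: le_trans (rnorm_cmul _ _) _; rewrite rnorm_star.
  apply: le_trans (ler_wpM2l (rnorm_ge0 _) (b2 _)) _.
  have := rnorm_cmul w b; have := rnorm_ge0 w; have := addr_ge0 S0 nu0.
  rewrite /nu expr2; move: (rnorm w) (rnorm (w *c b)) (rnorm b) (S + _) => x t s k.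
  move=> k0 x0 tx; rewrite -!mulrA ler_wpM2l// mulrC mulrA; nra.
rewrite leNgt; apply/negP => Snu.
have p4 := poly_pos_CD HNy b3.
have p5 : poly_pos (poly_norm y) (nu%:P + 'X).
  by apply: (poly_pos_CD HNy); rewrite poly_normX// ny.
have p6 : poly_pos (poly_norm y) (S%:P - 'X).
  apply/op_posE; apply: op_pos_ext p1' => b.
  by rewrite poly_actB poly_actC poly_actX.
have nuS : 0 <= nu - S by rewrite subr_ge0 ltW.
have d0 : 0 < nu + nu - S by lra.
set B := (nu - S) * (nu * (S + nu)) + nu * (nu * S).
have B0 : 0 <= B by apply: addr_ge0; do ?apply: mulr_ge0 => //; exact: addr_ge0.
(* The weights nu - S and nu are those for which the linear terms of [p4] and of [p5] times [p6]
   cancel. An upper bound for y^2 remains. *)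
have p7 : poly_pos (poly_norm y) (B%:P - (nu + nu - S)%:P * 'X ^+ 2).
  have -> : B%:P - (nu + nu - S)%:P * 'X ^+ 2 =
     (nu - S)%:P * ((nu * (S + nu))%:P + (nu%:P * 'X - 'X ^+ 2))
     + nu%:P * ((nu%:P + 'X) * (S%:P - 'X)).
    by rewrite /B; ring.
  apply: (poly_posD HNy).
    by apply: (poly_posM HNy) p4; exact: (poly_posC HNy).
  by apply: (poly_posM HNy) (poly_posM HNy p5 p6); exact: (poly_posC HNy).
have p8 : poly_pos (poly_norm y) ((nu + nu - S)%:P * 'X ^+ 2).
  apply: (poly_posM HNy) (poly_pos_sqr HNy _).
  by apply: (poly_posC HNy); exact: ltW.
have := poly_pos_norm HNy B0 p8 p7.
have := seminormC HNy (nu + nu - S)^-1 ((nu + nu - S)%:P * 'X ^+ 2).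
rewrite mulrA -polyCM mulVf ?gt_eqF// mul1r gtr0_norm ?invr_gt0//.
rewrite ler_pdivlMl//.
have := seminorm_sqr_le HNy 'X; rewrite poly_normX// ny /B.
move: (poly_norm y ('X ^+ 2)) (poly_norm y _) => s t hs ht tB.
have : (nu + nu - S) * nu ^+ 2 <= (nu - S) * (nu * (S + nu)) + nu * (nu * S).
  by apply: le_trans tB; apply: le_trans ht; rewrite ler_pM2l.
(* As y^2 has norm at least nu^2, [hf] reads nu (nu - S)^2 <= 0 after expansion, against S < nu. *)
move=> hf; have : 0 < nu * (nu - S) ^+ 2.
  apply: mulr_gt0; first exact: le_lt_trans S0 Snu.
  by rewrite exprn_gt0// subr_gt0.
lra.
Qed.

(** By [kaplansky_norm] the hypothesis applies to w divided by the square root of S, and gives S t +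
    u (1 - u)^2 >= 0. Adding u - u (1 - u)^2 = u^2 (2 - u) >= 0 yields S t + u >= 0. *)
Lemma kaplansky_step (t : R) : 0 <= t ->
  (forall h, rnorm h <= 1 ->
     poly_pos (poly_norm (star h *c h)) (t%:P + 'X)) ->
  forall h, rnorm h <= 1 ->
     poly_pos (poly_norm (star h *c h)) ((S * t)%:P + 'X).
Proof.
move=> t0 IH h h1; set u := star h *c h; set w := h - h *c u.
have hu : star u = u by rewrite starM starK.
have HN := poly_norm_seminorm hu.
have S0 : 0 < S by rewrite divr_gt0.
have sS0 : 0 < Num.sqrt S by rewrite sqrtr_gt0.
have u1 : rnorm u <= 1.
  by rewrite rnorm_cstar expr_le1 ?rnorm_ge0.
have w1 : rnorm ((Num.sqrt S)^-1 *r w) <= 1.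
  rewrite rnormZR gtr0_norm ?invr_gt0// -ler_pdivlMl ?invr_gt0// invrK mulr1.
  rewrite -(ler_pXn2r (n := 2)) ?nnegrE ?rnorm_ge0 ?sqrtr_ge0//.
  by rewrite sqr_sqrtr ?(ltW S0)//; exact: kaplansky_norm.
have /op_posE/(op_posZ (ltW S0)) p1 := IH _ w1.
have p2 : poly_pos (poly_norm u) ((S * t)%:P + cubic).
  apply/op_posE; apply: op_pos_ext p1 => b.
  rewrite !poly_actD !poly_actC -cubic_act -/u -/w poly_actX scalerDr -scaleCM.
  congr (_ + _); rewrite starZR !(cmulZl, cmulZr) -!scaleCM.
  have -> : S / Num.sqrt S / Num.sqrt S = 1.
    by rewrite -mulrA -invfM -expr2 sqr_sqrtr ?(ltW S0)// divff// gt_eqF.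
  by rewrite scale1r.
have -> : (S * t)%:P + 'X = (S * t)%:P + cubic + 'X ^+ 2 * (2%:P - 'X).
  have -> : 2%:P = 1 + 1 :> {poly R} by rewrite -[in LHS]natr1 polyCD polyC1.
  by rewrite /cubic; ring.
apply: (poly_posD HN p2); apply: (poly_posM HN (poly_pos_sqr HN _)).
by apply: (poly_pos_CB HN); rewrite poly_normX//; lra.
Qed.

(** After scaling to |h| <= 1 the bound -1 is trivial; n improvements turn it into -S^n, which tends
    to 0, and the positive cone is closed. *)
Lemma nonneg_star_mul h : nonneg (star h *c h).
Proof.
wlog h1 : h / rnorm h <= 1.
  move=> H; have n0 : 0 < rnorm h + 1 by rewrite ltr_wpDl ?rnorm_ge0.
  have -> : h = (rnorm h + 1) *r ((rnorm h + 1)^-1 *r h).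
    by rewrite -scaleCM divff ?gt_eqF// scale1r.
  rewrite starZR cmulZl cmulZr -scaleCM; apply: nonnegZ.
    by rewrite mulr_ge0// ltW.
  apply: H; rewrite rnormZR gtr0_norm ?invr_gt0// mulrC ler_pdivrMr// mul1r.
  by rewrite lerDl.
have hs : star (star h *c h) = star h *c h by rewrite starM starK.
split=> //; apply/op_posX.
have S0 : 0 <= S by rewrite divr_ge0.
have H n : forall h, rnorm h <= 1 ->
     poly_pos (poly_norm (star h *c h)) ((S ^+ n)%:P + 'X).
  elim: n => [|n IH] k k1; last first.
    by rewrite exprS; apply: kaplansky_step => //; exact: exprn_ge0.
  have hk : star (star k *c k) = star k *c k by rewrite starM starK.
  apply: (poly_pos_CD (poly_norm_seminorm hk)).
  by rewrite expr0 poly_normX// rnorm_cstar expr_le1 ?rnorm_ge0.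
apply: poly_pos_lim => // e e0.
have Sn0 : S ^+ n @[n --> \oo] --> (0 : R).
  by apply: cvg_expr; rewrite ger0_norm// /S; lra.
have /cvgrPdist_lt/(_ _ e0) [n _ /(_ n (leqnn n))] := Sn0.
rewrite /= sub0r normrN ger0_norm ?exprn_ge0// => Sne.
have HN := poly_norm_seminorm hs.
have -> : e%:P + 'X = (e - S ^+ n)%:P + ((S ^+ n)%:P + 'X).
  by rewrite polyCB; ring.
apply: (poly_posD HN) (H n _ h1).
by apply: (poly_posC HN); rewrite subr_ge0 ltW.
Qed.

Lemma is_positive_nonneg a : is_positive a -> nonneg a.
Proof. by move=> [h ->]; exact: nonneg_star_mul. Qed.

End Kaplansky.

(** * Cauchy-Schwarz inequality for weighted sums *)

Section CauchySchwarz.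
Context {R : realType} {A : cstarAlgType R}.
Variables (I : Type) (r : seq I) (m : I -> R).
Hypothesis m_ge0 : forall i, 0 <= m i.

Lemma nonneg_normB (u v : A) : nonneg u -> nonneg (v - u) -> rnorm u <= rnorm v.
Proof. by move=> hu hv; have := nonneg_norm_le hu hv; rewrite addrC subrK. Qed.

(** Expanding the positive sum of the m [star (t p s - q) *c (t p s - q)] gives 2 t [star s *c s] <=
    t^2 [star s *c x *c s] + y, and the norm is monotone. The optimal t is 1 / |x|; if |x| = 0, a
    large t forces s = 0. *)
Lemma cstar_cauchy_schwarz (p q : I -> A) :
  rnorm (\sum_(i <- r) m i *r (star (p i) *c q i)) ^+ 2 <=
  rnorm (\sum_(i <- r) m i *r (star (p i) *c p i)) *
  rnorm (\sum_(i <- r) m i *r (star (q i) *c q i)).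
Proof.
set s := \sum_(i <- r) _; set x := \sum_(i <- r) _; set y := \sum_(i <- r) _.
have ss : star s = \sum_(i <- r) m i *r (star (q i) *c p i).
  by rewrite star_sum; apply: eq_bigr => i _; rewrite starZR starM starK.
have key (t : R) : 0 <= t ->
    (t + t) * rnorm s ^+ 2 <= t ^+ 2 * (rnorm s ^+ 2 * rnorm x) + rnorm y.
  move=> t0.
  have h1 : nonneg ((t + t) *r (star s *c s)).
    by apply: nonnegZ (nonneg_star_mul _); exact: addr_ge0.
  have h2 : nonneg (((t ^+ 2) *r (star s *c x *c s) + y) - (t + t) *r (star s *c s)).
    have -> : ((t ^+ 2) *r (star s *c x *c s) + y) - (t + t) *r (star s *c s) =
      \sum_(i <- r) m i *r (star (t *r (p i *c s) - q i) *c (t *r (p i *c s) - q i)).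
      have E i : m i *r (star (t *r (p i *c s) - q i) *c (t *r (p i *c s) - q i)) =
          (t ^+ 2) *r (star s *c (m i *r (star (p i) *c p i)) *c s)
          - t *r (star s *c (m i *r (star (p i) *c q i)))
          - t *r ((m i *r (star (q i) *c p i)) *c s)
          + m i *r (star (q i) *c q i).
        rewrite starB starZR cmulBl !cmulBr opprB addrA addrAC !(scalerDr, scalerN).
        by rewrite starM !(cmulZl, cmulZr) -!scaleCM !cmulA expr2 !(mulrC (m i)) (mulrAC t t).
      have E1 : \sum_(i <- r) (t ^+ 2) *r (star s *c (m i *r (star (p i) *c p i)) *c s)
          = (t ^+ 2) *r (star s *c x *c s).
        by rewrite -scaler_sumr -cmul_suml -cmul_sumr.
      have E2 : \sum_(i <- r) t *r (star s *c (m i *r (star (p i) *c q i)))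
          = t *r (star s *c s).
        by rewrite -scaler_sumr -cmul_sumr.
      have E3 : \sum_(i <- r) t *r ((m i *r (star (q i) *c p i)) *c s)
          = t *r (star s *c s).
        by rewrite -scaler_sumr -cmul_suml -ss.
      rewrite (eq_bigr _ (fun i _ => E i)) !big_split/= !sumrN E1 E2 E3.
      by rewrite scaleCD opprD addrA addrAC; congr (_ + _); rewrite addrAC.
    by apply: nonneg_sum => i _; apply: nonnegZ => //; exact: nonneg_star_mul.
  have := nonneg_normB h1 h2; rewrite rnormZR ger0_norm ?addr_ge0// rnorm_cstar.
  move=> /le_trans; apply; apply: le_trans (rnormD _ _) _; rewrite lerD2r.
  rewrite rnormZR ger0_norm ?sqr_ge0// ler_wpM2l ?sqr_ge0//.
  apply: le_trans (rnorm_cmul _ _) _.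
  apply: le_trans (ler_wpM2r (rnorm_ge0 _) (rnorm_cmul _ _)) _.
  by rewrite rnorm_star expr2 mulrAC.
have [x0|x0] := eqVneq (rnorm x) 0.
  rewrite x0 mul0r leNgt; apply/negP => s0.
  have [t t0 ht] : exists2 t, 0 <= t & t * rnorm s ^+ 2 = rnorm y + 1.
    exists ((rnorm y + 1) / rnorm s ^+ 2); last by rewrite divfK// gt_eqF.
    by rewrite divr_ge0 ?addr_ge0 ?rnorm_ge0// ltW.
  have := key t t0; rewrite x0 !mulr0 add0r mulrDl ht.
  by have := rnorm_ge0 y; lra.
have x0' : 0 < rnorm x by rewrite lt0r x0 rnorm_ge0.
have := key (rnorm x)^-1; rewrite invr_ge0 ltW// => /(_ isT).
have -> : (rnorm x)^-1 ^+ 2 * (rnorm s ^+ 2 * rnorm x) = (rnorm x)^-1 * rnorm s ^+ 2.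
  by field.
by rewrite mulrDl lerD2l ler_pdivrMl.
Qed.

(** Each term is the product of the adjoint of [conjc x *: h] with [h *c xi]. In the first factor of
    Cauchy-Schwarz the unimodular x cancels; in the second, a is replaced by the larger b. *)
Lemma weighted_sum_dominated (a b : I -> A) (h g xi : I -> A) (x : I -> R[i]) :
  (forall i, a i = star (h i) *c h i) ->
  (forall i, b i - a i = star (g i) *c g i) ->
  (forall i, x i * conjc (x i) = 1) ->
  rnorm (\sum_(i <- r) m i *r (x i *: (a i *c xi i))) ^+ 2 <=
  rnorm (\sum_(i <- r) m i *r a i) *
  rnorm (\sum_(i <- r) m i *r (star (xi i) *c b i *c xi i)).
Proof.
move=> ah bg x1.
have := cstar_cauchy_schwarz (fun i => conjc (x i) *: h i) (fun i => h i *c xi i).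
rewrite (eq_bigr (fun i => m i *r (x i *: (a i *c xi i)))); last first.
  by move=> i _; rewrite star_scale conjcK cmulZl cmulA -ah.
rewrite [in X in X * _](eq_bigr (fun i => m i *r a i)); last first.
  by move=> i _; rewrite star_scale conjcK cmulZl cmulZr scalerA x1 scale1r -ah.
move=> /le_trans; apply; rewrite ler_wpM2l ?rnorm_ge0//.
apply: nonneg_normB.
  by apply: nonneg_sum => i _; apply: nonnegZ => //; exact: nonneg_star_mul.
rewrite -sumrB; apply: nonneg_sum => i _; rewrite -scalerBr.
have -> : star (xi i) *c b i *c xi i - star (h i *c xi i) *c (h i *c xi i) =
    star (g i *c xi i) *c (g i *c xi i).
  rewrite !starM -!cmulA (cmulA (star (h i))) (cmulA (star (g i))) -ah -bg.
  by rewrite cmulBl cmulBr.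
by apply: nonnegZ => //; exact: nonneg_star_mul.
Qed.

End CauchySchwarz.

(** * Bochner integrals of continuous functions *)

Section FiniteValued.
Context {R : realType} {d : measure_display} {T : measurableType d}.
Variable mu : {measure set T -> \bar R}.

(** The values may lie in any type, so that maps sampling points of the group are covered as well as
    simple functions. *)
Definition finite_valued (I : Type) (tau : T -> I) : Prop :=
  finite_set (range tau) /\ forall g, measurable (tau @^-1` [set g]).

Definition fiber_measure (I : Type) (K : set T) (tau : T -> I) (g : I) : R :=
  fine (mu (K `&` tau @^-1` [set g])).

(** For a map tau sampling points of K, this is the Riemann sum of phi. *)
Definition fiber_sum (V : lmodType R[i]) (I : choiceType) (K : set T)
    (tau : T -> I) (phi : I -> V) : V :=
  \sum_(g <- fset_set (range tau)) ((fiber_measure K tau g)%:C)%C *: phi g.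

Lemma fiber_measure_ge0 (I : Type) K (tau : T -> I) g : 0 <= fiber_measure K tau g.
Proof. exact: fine_ge0. Qed.

Section Fibers.
Variables (I : choiceType) (tau : T -> I).
Hypothesis htau : finite_valued tau.

Lemma in_tags t : tau t \in fset_set (range tau).
Proof. by case: htau => fin _; rewrite in_fset_set// mem_set//; exists t. Qed.

Lemma finite_valued_preimage (B : set I) : measurable (tau @^-1` B).
Proof.
have [fin meas] := htau.
have -> : tau @^-1` B = \bigcup_(g in range tau `&` B) (tau @^-1` [set g]).
  apply/seteqP; split => [t Bt|t [g [_ Bg] /= tg]]; last by rewrite /= tg.
  by exists (tau t).
apply: fin_bigcup_measurable => //; apply: sub_finite_set fin.
exact: subIsetl.
Qed.

Lemma finite_valued_measurable d' (T' : measurableType d') (phi : I -> T') (D : set T) :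
  measurable_fun D (phi \o tau).
Proof.
apply: measurable_funTS => _ B mB; rewrite setTI.
exact: (finite_valued_preimage (phi @^-1` B)).
Qed.

Lemma trivIset_fibers (K : set T) (S : set I) :
  trivIset S (fun g => K `&` tau @^-1` [set g]).
Proof. by move=> g h _ _ [t [[_ /= <-] [_ /= <-]]]. Qed.

Lemma bigcup_fibers (K : set T) :
  \big[setU/set0]_(g <- fset_set (range tau)) (K `&` tau @^-1` [set g]) = K.
Proof.
rewrite -bigcup_fset; apply/seteqP; split => [t [g _ []]//|t Kt].
by exists (tau t) => //=; exact: in_tags.
Qed.

Lemma measure_fibers (K : set T) : measurable K ->
  mu K = (\sum_(g <- fset_set (range tau)) mu (K `&` tau @^-1` [set g]))%E.
Proof.
move=> mK; rewrite -{1}(bigcup_fibers K) measure_fbigsetU//.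
  by move=> g _; apply: measurableI => //; exact: finite_valued_preimage.
exact: trivIset_fibers.
Qed.

Lemma fiber_fin_num (K : set T) g : measurable K -> (mu K < +oo)%E ->
  mu (K `&` tau @^-1` [set g]) \is a fin_num.
Proof.
move=> mK Koo; rewrite ge0_fin_numE//; apply: le_lt_trans Koo.
have mKg : measurable (K `&` tau @^-1` [set g]).
  by apply: measurableI => //; exact: finite_valued_preimage.
by apply: le_measure => //; exact: mem_set.
Qed.

Lemma fiber_measureD (K D : set T) g : measurable K -> measurable D ->
  (mu K < +oo)%E -> (mu D < +oo)%E -> K `&` D = set0 ->
  fiber_measure (K `|` D) tau g = fiber_measure K tau g + fiber_measure D tau g.
Proof.
move=> mK mD Koo Doo KD; rewrite /fiber_measure setIUl measureU.
- by rewrite fineD ?fiber_fin_num.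
- by apply: measurableI => //; exact: finite_valued_preimage.
- by apply: measurableI => //; exact: finite_valued_preimage.
- by rewrite setIACA KD set0I.
Qed.

Lemma integral_fibers (K : set T) (rho : I -> R) : measurable K ->
  (mu K < +oo)%E -> (forall g, 0 <= rho g) ->
  (\int[mu]_(t in K) (rho (tau t))%:E)%E =
  (\sum_(g <- fset_set (range tau)) fiber_measure K tau g * rho g)%:E.
Proof.
move=> mK Koo rho0; rewrite -{1}(bigcup_fibers K) ge0_integral_bigsetU//=.
- rewrite -sumEFin; apply: eq_bigr => g _.
  rewrite (eq_integral (cst (rho g)%:E)); last by move=> t /set_mem[_ /= ->].
  rewrite integral_cst; last first.
    by apply: measurableI => //; exact: finite_valued_preimage.
  by rewrite muleC EFinM /fiber_measure fineK// fiber_fin_num.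
- by move=> g; apply: measurableI => //; exact: finite_valued_preimage.
- exact: trivIset_fibers.
- exact: (finite_valued_measurable (fun g => (rho g)%:E)).
- by move=> t _; rewrite lee_fin.
Qed.

End Fibers.

Section SimpleIntegral.
Context {V : completeNormedModType R[i]}.
Variable K : set T.
Hypotheses (mK : measurable K) (Koo : (mu K < +oo)%E).

Lemma simple_on_finite_valued (s : T -> V) : simple_on mu K s -> finite_valued s.
Proof. by case. Qed.

Lemma finite_valued_simple_on (s : T -> V) : finite_valued s -> simple_on mu K s.
Proof.
move=> hs; have [fin meas] := hs; split => // v _.
by rewrite -ge0_fin_numE//; exact: (fiber_fin_num (I := V) hs v mK Koo).
Qed.

Lemma finite_valued_comp (I : choiceType) (tau : T -> I) (phi : I -> V) :
  finite_valued tau -> finite_valued (phi \o tau).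
Proof.
move=> ht; split; last first.
  by move=> v; exact: (finite_valued_preimage ht (phi @^-1` [set v])).
case: ht => fin _; apply: sub_finite_set (finite_image phi fin).
by move=> _ [t _ <-]; exists (tau t) => //; exists t.
Qed.

(** A level set of the composite is the union of the fibers that phi sends to the same value;
    exchanging the two sums leaves one term per fiber. *)
Lemma simple_integral_comp (I : choiceType) (tau : T -> I) (phi : I -> V) :
  finite_valued tau -> simple_integral mu K (phi \o tau) = fiber_sum K tau phi.
Proof.
move=> ht; have hs := finite_valued_comp phi ht.
rewrite /simple_integral fsbig_finite/=; last by case: hs.
have E v : fine (mu (K `&` (phi \o tau) @^-1` [set v])) =
    \sum_(g <- fset_set (range tau)) (phi g == v)%:R * fiber_measure K tau g.
  have mKv : measurable (K `&` (phi \o tau) @^-1` [set v]).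
    by apply: measurableI => //; exact: (finite_valued_preimage hs).
  have Kvoo : (mu (K `&` (phi \o tau) @^-1` [set v]) < +oo)%E.
    by rewrite -ge0_fin_numE// (fiber_fin_num hs).
  rewrite (measure_fibers ht mKv) -sum_fine => [|g _]; last exact: (fiber_fin_num ht).
  apply: eq_bigr => g _; have [<-|gv] := eqVneq (phi g) v.
    rewrite mul1r; congr (fine (mu _)); apply/seteqP; split => t /=.
      by move=> [[Kt _] tg].
    by move=> [Kt tg]; rewrite tg.
  rewrite mul0r (_ : _ `&` _ = set0) ?measure0//.
  rewrite -subset0 => t /= [[_ tv] tg]; move/eqP: gv; apply; by rewrite -tg.
under eq_bigr do rewrite E rmorph_sum/= scaler_suml.
rewrite exchange_big/=; apply: eq_big_seq => g gin.
have [ft _] := ht; have [fs _] := hs.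
have [t _ tg] : range tau g by apply/set_mem; rewrite -in_fset_set.
rewrite (bigD1_seq (phi g))/= ?fset_uniq//; last first.
  by rewrite in_fset_set// mem_set//; exists t => //=; rewrite tg.
rewrite eqxx mul1r big1 ?addr0// => v vg.
by rewrite eq_sym (negbTE vg) mul0r scale0r.
Qed.

Lemma finite_valued_pair (s s' : T -> V) : finite_valued s -> finite_valued s' ->
  finite_valued (fun t => (s t, s' t)).
Proof.
move=> [fs ms] [fs' ms']; split.
  apply: sub_finite_set (finite_setX fs fs') => _ [t _ <-].
  by split => /=; exists t.
move=> [v v']; have -> : (fun t => (s t, s' t)) @^-1` [set (v, v')] =
    s @^-1` [set v] `&` s' @^-1` [set v'].
  by apply/seteqP; split => t; case=> <- <-.
exact: measurableI.
Qed.

(** Both functions factor through t |-> (s t, s' t), whose fibers are a common refinement of their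
    level sets. *)
Lemma simple_integral_dist (s s' : T -> V) :
  simple_on mu K s -> simple_on mu K s' ->
  ((rnorm (simple_integral mu K s - simple_integral mu K s'))%:E <=
   \int[mu]_(t in K) (rnorm (s t - s' t))%:E)%E.
Proof.
move=> /simple_on_finite_valued hs /simple_on_finite_valued hs'.
pose tau t := (s t, s' t); have ht : finite_valued tau by exact: finite_valued_pair.
have -> : s = fst \o tau by [].
have -> : s' = snd \o tau by [].
rewrite !simple_integral_comp//=.
rewrite (integral_fibers ht (rho := fun g => rnorm (g.1 - g.2)))//; last first.
  by move=> g; exact: rnorm_ge0.
rewrite lee_fin /fiber_sum -sumrB; apply: le_trans (rnorm_sum _ _ _) _.
apply: ler_sum => g _; rewrite -scalerBr rnormZR ger0_norm//.
exact: fiber_measure_ge0.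
Qed.

End SimpleIntegral.
End FiniteValued.

(** * Limits in terms of the real-valued norm *)

Section RealNormLimits.
Context {R : realType}.

Lemma cvg_rnormP {V : normedModType R[i]} {T : Type} {F : set_system T}
    {FF : Filter F} (f : T -> V) (l : V) :
  f @ F --> l <-> forall e : R, 0 < e -> \forall t \near F, rnorm (l - f t) < e.
Proof.
split=> [/cvgrPdist_lt h e e0|h].
  have e0' : 0 < (e%:C)%C by rewrite ltcR.
  by apply: filterS (h _ e0') => t; rewrite rnormE ltcR.
apply/cvgrPdist_lt => e e0; have eE : e = ((complex.Re e)%:C)%C.
  by rewrite RRe_real// gtr0_real.
move: e0; rewrite eE ltcR => e0; apply: filterS (h _ e0) => t.
by rewrite rnormE ltcR.
Qed.

Lemma rnorm_cauchy_cvg {V : completeNormedModType R[i]} {T : Type}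
    {F : set_system T} {FF : ProperFilter F} (f : T -> V) :
  (forall e : R, 0 < e -> exists2 P : set T, F P &
     forall s t, P s -> P t -> rnorm (f s - f t) < e) ->
  cvg (f @ F).
Proof.
move=> h; apply/cauchy_cvgP/cauchyP => e e0.
have eE : e = ((complex.Re e)%:C)%C by rewrite RRe_real// gtr0_real.
move: e0; rewrite eE ltcR => e0; have [P FP hP] := h _ e0.
have [s Ps] := filter_ex FP; exists (f s).
suff : \forall t \near F, ball (f s) ((complex.Re e)%:C)%C (f t) by [].
apply: filterS FP => t Pt; rewrite /= -ball_normE /ball_/= rnormE ltcR.
exact: hP.
Qed.

Lemma cvg_rnorm {V : normedModType R[i]} {T : Type} {F : set_system T}
    {FF : Filter F} (f : T -> V) (l : V) :
  f @ F --> l -> rnorm (f t) @[t --> F] --> rnorm l.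
Proof.
move=> /cvg_rnormP h; apply/cvgrPdist_lt => e e0.
apply: filterS (h e e0) => t; apply: le_lt_trans.
have h1 := rnormD (l - f t) (f t); have h2 := rnormD (f t - l) l.
rewrite !subrK in h1 h2; rewrite (rnormBC (f t)) in h2.
by rewrite ler_norml; apply/andP; split; lra.
Qed.

Lemma rnorm_eq_lim {V : normedModType R[i]} {T : Type} {F : set_system T}
    {FF : ProperFilter F} (f : T -> V) (l l' : V) :
  f @ F --> l -> f @ F --> l' -> l = l'.
Proof. by move=> h h'; apply: (cvg_unique (@norm_hausdorff _ V) h h'). Qed.

Lemma ler_lim_near {T : Type} {F : set_system T} {FF : ProperFilter F}
    (f g : T -> R) (l l' : R) :
  f @ F --> l -> g @ F --> l' -> (\forall t \near F, f t <= g t) -> l <= l'.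
Proof.
move=> fl gl fg; rewrite leNgt; apply/negP => ll'.
have d0 : 0 < (l - l') / 2 by rewrite divr_gt0 ?subr_gt0.
have /cvgrPdist_lt/(_ _ d0) hf := fl; have /cvgrPdist_lt/(_ _ d0) hg := gl.
have [t [[ft gt] fgt]] := filter_ex (filterI (filterI hf hg) fg).
move: ft gt; rewrite !ltr_norml => /andP[_ ft] /andP[gt _]; lra.
Qed.

Lemma cvg_cmul {A : cstarAlgType R} {T : Type} {F : set_system T}
    {FF : Filter F} (f g : T -> A) (a b : A) :
  f @ F --> a -> g @ F --> b -> f t *c g t @[t --> F] --> a *c b.
Proof.
move=> /cvg_rnormP hf /cvg_rnormP hg; apply/cvg_rnormP => e e0.
have a0 := rnorm_ge0 a; have b0 := rnorm_ge0 b.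
pose d := Num.min 1 (e / (rnorm a + rnorm b + 2)).
have d0 : 0 < d by rewrite lt_min ltr01 divr_gt0//; lra.
have [d1 de] : d <= 1 /\ d <= e / (rnorm a + rnorm b + 2).
  by rewrite !ge_min !lexx orbT.
move: de; rewrite ler_pdivlMr => [de|]; last by lra.
apply: filterS2 (hf d d0) (hg d d0) => t ft gt.
have -> : a *c b - f t *c g t = (a - f t) *c b + a *c (b - g t)
    - (a - f t) *c (b - g t).
  by rewrite -addrA -[X in _ = _ + X]cmulBl subKr cmulBl cmulBr addrA subrK.
apply: le_lt_trans (rnormB _ _) _.
have h1 := rnormD ((a - f t) *c b) (a *c (b - g t)).
have h2 := rnorm_cmul (a - f t) b; have h3 := rnorm_cmul a (b - g t).
have h4 := rnorm_cmul (a - f t) (b - g t).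
have := rnorm_ge0 (a - f t); have := rnorm_ge0 (b - g t).
move: (rnorm (a - f t)) (rnorm (b - g t)) ft gt h2 h3 h4 => x y xd yd h2 h3 h4 y0 x0.
nra.
Qed.

Lemma cvg_star {A : cstarAlgType R} {T : Type} {F : set_system T}
    {FF : Filter F} (f : T -> A) (a : A) :
  f @ F --> a -> star (f t) @[t --> F] --> star a.
Proof.
move=> /cvg_rnormP hf; apply/cvg_rnormP => e e0.
by apply: filterS (hf e e0) => t; rewrite -starB rnorm_star.
Qed.

End RealNormLimits.

(** * Sampling maps on a topological group *)

Section Tagging.
Context {G : topologicalZmodType}.

Lemma open_borel_measurable (U : set G) :
  open U -> measurable (U : set (borel G)).
Proof. exact: sub_sigma_algebra. Qed.

(* The functions [tau] sampling the points of [L]: each [t] in [L] is replaced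
   by a point [tau t], one out of finitely many, such that [t] lies in the
   neighborhood [N (tau t)].  The limit along this filter plays the role of the
   limit of Riemann sums. *)
Definition tagging : set_system (borel G -> G) :=
  filter_from [set LN : set G * (G -> set G) |
                 precompact LN.1 /\ forall g, nbhs g (LN.2 g)]
    (fun LN => [set tau : borel G -> G | finite_valued tau /\ forall t, LN.1 t -> LN.2 (tau t) t]).

(** Taking the first match turns an open cover into a Borel partition; points off the cover get the
    value 0. *)
Fixpoint first_tag (U : G -> set G) (s : seq G) (t : borel G) : G :=
  if s is g :: s' then if `[< U g t >] then g else first_tag U s' t else 0.

Lemma first_tag_finite_valued U s : (forall g, open (U g)) ->
  finite_valued (first_tag U s).
Proof.
move=> oU; elim: s => [|g s [fin meas]] /=.
  split; first by apply: (sub_finite_set _ (finite_set1 (0 : G))) => _ [t _ <-].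
  move=> g; have [->|g0] := eqVneq g 0.
    rewrite (_ : _ @^-1` _ = setT); first exact: measurableT.
    by apply/seteqP; split.
  rewrite (_ : _ @^-1` _ = set0); first exact: measurable0.
  by rewrite -subset0 => t /= /esym/eqP; rewrite (negbTE g0).
split.
  apply: sub_finite_set (_ : finite_set ([set g] `|` range (first_tag U s))).
    by move=> _ [t _ <-]; case: asboolP => _; [left|right; exists t].
  by rewrite finite_setU; split.
move=> h; have mU := open_borel_measurable (oU g).
have -> : (fun t : borel G => if `[< U g t >] then g else first_tag U s t) @^-1` [set h]
    = (U g `&` [set t : borel G | g = h]) `|` (~` (U g) `&` first_tag U s @^-1` [set h]).
  apply/seteqP; split => [t /=|t].
    by case: asboolP => Ut gh; [left|right].
  by case=> -[/= Ut]; case: asboolP.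
apply: measurableU; last by apply: measurableI => //; exact: measurableC.
have [<-|gh] := eqVneq g h.
  have -> : [set t : borel G | g = g] = setT by apply/seteqP; split.
  by rewrite setIT.
have -> : [set t : borel G | g = h] = set0; last by rewrite setI0.
by rewrite -subset0 => t /= /eqP; rewrite (negbTE gh).
Qed.

(** Finitely many of the interiors of the [N g] cover the compact closure of L; their centers are
    the tags. *)
Lemma tagging_exists (L : set G) (N : G -> set G) :
  precompact L -> (forall g, nbhs g (N g)) ->
  exists tau : borel G -> G, finite_valued tau /\ forall t, L t -> N (tau t) t.
Proof.
pose pG : ptopologicalType := HB.pack (G : Type)
  (TopologicalZmodule.class G) (isPointed.Build (G : Type) (0 : G)).
rewrite precompactE => cL hN.
have {}cL : @cover_compact pG (closure L) by rewrite -compact_cover.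
have [|D _ hD] := cL G setT (fun g => interior (N g)) (fun g _ => @open_interior _ _).
  by move=> t _; exists t => //; exact: hN.
have oN g : open (interior (N g)) by exact: open_interior.
exists (first_tag (fun g => interior (N g)) D); split.
  exact: first_tag_finite_valued.
move=> t Lt; have [g /= gD Ngt] := hD _ (subset_closure Lt).
have {gD} : g \in (D : seq G) by [].
elim: (D : seq G) => //= h s IH; case: asboolP => [ht _|ht].
  exact: interior_subset.
by rewrite inE => /predU1P[gh|//]; rewrite gh in Ngt.
Qed.

Global Instance tagging_proper : ProperFilter tagging.
Proof.
apply: filter_from_proper; last first.
  by move=> [L N] /= [hL hN]; exact: tagging_exists.
apply: filter_from_filter.
  exists (set0, fun=> setT); split => /=; last by move=> g; exact: filterT.
  by rewrite precompactE closure0; exact: compact0.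
move=> [L N] [L' N'] /= [hL hN] [hL' hN'].
exists (L `|` L', fun g => N g `&` N' g) => /=.
  split; last by move=> g; exact: filterI.
  by move: hL hL'; rewrite !precompactE closureU; exact: compactU.
move=> tau /= [ht h].
by split; split => // t Lt; have [|//] := h t; [left|..|right].
Qed.

Lemma tagging_near (L : set G) (N : G -> set G) :
  precompact L -> (forall g, nbhs g (N g)) ->
  \forall tau \near tagging,
    finite_valued (tau : borel G -> G) /\ forall t, L t -> N (tau t) t.
Proof. by move=> hL hN; exists (L, N). Qed.

End Tagging.

(** * Bochner integrals as limits of Riemann sums *)

Section BochnerContinuous.
Context {R : realType} {G : topologicalZmodType}.
Variable mu : {measure set (borel G) -> \bar R}.
Hypothesis mu_compact : forall K : set G, compact K -> (mu K < +oo)%E.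

Lemma rcompact_fin (K : set (borel G)) : rcompact K -> (mu K < +oo)%E.
Proof.
move=> [mK]; rewrite precompactE => cK.
apply: le_lt_trans (mu_compact cK); apply: le_measure; last exact: subset_closure.
  exact: mem_set.
apply/mem_set; rewrite -[X in measurable X]setCK; apply: measurableC.
apply: open_borel_measurable; apply: closed_openC; exact: closed_closure.
Qed.

Lemma rcompactU (K L : set (borel G)) : rcompact K -> rcompact L -> rcompact (K `|` L).
Proof.
move=> [mK cK] [mL cL]; split; first exact: measurableU.
by move: cK cL; rewrite !precompactE closureU; exact: compactU.
Qed.

Lemma rcompactD (K L : set (borel G)) : rcompact K -> rcompact L -> rcompact (K `\` L).
Proof.
move=> [mK cK] [mL cL]; split; first exact: measurableD.
by apply: precompact_subset cK; exact: subDsetl.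
Qed.

Lemma rcompact0 : rcompact (set0 : set (borel G)).
Proof.
by split; [exact: measurable0 | rewrite precompactE closure0; exact: compact0].
Qed.

Global Instance rcompact_net_proper : ProperFilter (@rcompact_net G).
Proof.
apply: filter_from_proper; last by move=> K hK; exists K; split.
apply: filter_from_filter; first by exists set0; exact: rcompact0.
move=> K L hK hL; exists (K `|` L); first exact: rcompactU.
move=> M [hM KLM]; split; split => // t ht; apply: KLM; by [left|right].
Qed.

Section Integral.
Context {V : completeNormedModType R[i]}.
Implicit Types (f : G -> V) (s : borel G -> V).

Lemma near_rnorm f (g : G) (e : R) : continuous f -> 0 < e ->
  nbhs g [set t | rnorm (f t - f g) < e].
Proof.
move=> cf e0; have /cvg_rnormP/(_ e e0) := cf g.
by apply: filterS => t; rewrite rnormBC.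
Qed.

(** On each of the finitely many fibers of s the function is the continuous t |-> |f t - v|, so
    nothing is asked about the measurability of vector-valued differences. *)
Lemma measurable_rnorm_dist f s (D : set (borel G)) : continuous f -> finite_valued s ->
  measurable_fun D (fun t => (rnorm (f t - s t))%:E : \bar R).
Proof.
move=> cf hs; apply: measurable_funTS; apply/measurable_EFinP.
apply: (measurability _ (RGenOInfty.measurableE R)) => _ [_ [x ->] <-].
rewrite setTI.
have -> : (fun t => rnorm (f t - s t)) @^-1` `]x, +oo[%classic =
   \bigcup_(v in range s) (s @^-1` [set v] `&` [set t | x < rnorm (f t - v)]).
  apply/seteqP; split => [t /=|t [v _ [/= <-]]]; rewrite ?in_itv/= ?andbT// => xt.
  by exists (s t).
apply: fin_bigcup_measurable => [|v _]; first by case: hs.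
apply: measurableI; first by case: hs.
apply: open_borel_measurable.
have cr : continuous (fun t : G => rnorm (f t - v)).
  by move=> t; apply: cvg_rnorm; apply: cvgB; [exact: cf | exact: cvg_cst].
exact: (open_comp (fun t _ => cr t) (@open_gt _ x)).
Qed.

Variables (K : set (borel G)) (hK : rcompact K).
Let mK : measurable K. Proof. by case: hK. Qed.
Let Koo := rcompact_fin hK.

Lemma integral_bound (h : borel G -> R) (e : R) : 0 <= e ->
  measurable_fun K (fun t => (h t)%:E) -> (forall t, 0 <= h t) ->
  (forall t, K t -> h t <= e) ->
  (\int[mu]_(t in K) (h t)%:E <= (e * fine (mu K))%:E)%E.
Proof.
move=> e0 mh h0 he; have -> : ((e * fine (mu K))%:E = \int[mu]_(t in K) (cst e%:E) t)%E.
  by rewrite integral_cst// EFinM fineK// ge0_fin_numE.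
by apply: ge0_le_integral => // t Kt; rewrite lee_fin ?he.
Qed.

(** The two errors are measured differently on purpose: s is uniformly close to f, while s' comes
    from an approximating sequence, known to be close in mean only. *)
Lemma simple_integral_close f s s' (e : R) : continuous f -> 0 <= e ->
  finite_valued s -> finite_valued s' ->
  (forall t, K t -> rnorm (f t - s t) <= e) ->
  ((rnorm (simple_integral mu K s' - simple_integral mu K s))%:E <=
   \int[mu]_(t in K) (rnorm (f t - s' t))%:E + (e * fine (mu K))%:E)%E.
Proof.
move=> cf e0 hs hs' he.
apply: le_trans (simple_integral_dist mK Koo _ _) _; try exact: finite_valued_simple_on.
have c0 : continuous (cst 0 : G -> V) by move=> t; exact: cvg_cst.
have hB : finite_valued (fun t => s t - s' t).
  by have := finite_valued_comp (fun g => g.1 - g.2) (finite_valued_pair hs hs').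
apply: (@le_trans _ _ (\int[mu]_(t in K) ((rnorm (f t - s' t))%:E + (rnorm (f t - s t))%:E))%E).
  apply: ge0_le_integral => //.
  - by move=> t _; rewrite lee_fin rnorm_ge0.
  - have := measurable_rnorm_dist (D := K) c0 hB.
    by congr (measurable_fun _ _); apply/funext => t; rewrite sub0r opprB.
  - by apply: emeasurable_funD; exact: measurable_rnorm_dist.
  - move=> t Kt; rewrite -EFinD lee_fin.
    have -> : s' t - s t = (f t - s t) - (f t - s' t).
      by rewrite opprB [RHS]addrC addrA subrK.
    by apply: le_trans (rnormB _ _) _; rewrite addrC.
rewrite ge0_integralD//; try by move=> t _; rewrite lee_fin rnorm_ge0.
- rewrite leeD2l//; apply: integral_bound => //.
    exact: measurable_rnorm_dist.
  by move=> t; exact: rnorm_ge0.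
- exact: measurable_rnorm_dist.
- exact: measurable_rnorm_dist.
Qed.

(** Sampling f with precision 1 / (n + 1) gives uniform approximation on K, and K has finite
    measure. *)
Lemma bochner_approx_exists f : continuous f ->
  exists2 s, bochner_approx mu K f s & cvg (simple_integral mu K (s n) @[n --> \oo]).
Proof.
move=> cf.
have hs (n : nat) : exists s : borel G -> V,
    finite_valued s /\ forall t, K t -> rnorm (f t - s t) <= n.+1%:R^-1.
  have [|tau [ht htau]] := @tagging_exists G K
      (fun g => [set t | rnorm (f t - f g) < n.+1%:R^-1]) (proj2 hK).
    by move=> g; apply: near_rnorm => //; rewrite invr_gt0.
  exists (f \o tau); split; first exact: finite_valued_comp.
  by move=> t /htau /= /ltW.
have [s /all_and2[fs s_le]] := choice hs.
have n0 : (fun n : nat => n.+1%:R^-1 : R) @ \oo --> (0 : R) by exact: cvg_harmonic.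
have ms n (D : set (borel G)) : measurable_fun D (fun t => (rnorm (f t - s n t))%:E : \bar R).
  exact: measurable_rnorm_dist.
have bd n : (\int[mu]_(t in K) (rnorm (f t - s n t))%:E <= (n.+1%:R^-1 * fine (mu K))%:E)%E.
  apply: integral_bound => //; first by move=> t; exact: rnorm_ge0.
  exact: s_le.
have nK0 : (fun n : nat => n.+1%:R^-1 * fine (mu K)) @ \oo --> (0 : R).
  by rewrite -(mul0r (fine (mu K))); apply: cvgMr_tmp.
exists s.
- split.
  + by move=> n; exact: finite_valued_simple_on.
  + apply: aeW => t Kt; apply/cvg_rnormP => e e0.
    have /cvgrPdist_lt/(_ e e0) := n0; apply: filterS => n.
    rewrite sub0r normrN ger0_norm ?invr_ge0//; apply: le_lt_trans.
    exact: s_le.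
  + apply: (@squeeze_cvge _ _ _ _ (cst 0%E) _ (fun n => (n.+1%:R^-1 * fine (mu K))%:E)).
    * near=> n; rewrite bd andbT; apply: integral_ge0 => t _.
      by rewrite lee_fin rnorm_ge0.
    * exact: cvg_cst.
    * by apply: cvg_EFin => //; exact: nearW.
- apply: rnorm_cauchy_cvg => e e0; have e20 : 0 < e / 2 by rewrite divr_gt0.
  have /cvgrPdist_lt/(_ _ e20) nK := nK0.
  eexists; first exact: nK.
  move=> n m /=; rewrite !sub0r !normrN !ger0_norm ?mulr_ge0 ?invr_ge0 ?fine_ge0//.
  move=> hn hm; rewrite -lte_fin.
  apply: le_lt_trans (simple_integral_close cf _ (fs m) (fs n) (s_le m)) _.
    by rewrite invr_ge0.
  apply: le_lt_trans (leeD2r _ (bd n)) _.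
  by rewrite -EFinD lte_fin [ltRHS](splitr e) ltrD.
Unshelve. all: by end_near.
Qed.

(** The integral is the limit along some unspecified approximating sequence s'. Whatever s' is, its
    error in mean vanishes in the limit of [simple_integral_close]. *)
Lemma bochner_integral_close f s (e : R) : continuous f -> 0 <= e ->
  finite_valued s -> (forall t, K t -> rnorm (f t - s t) <= e) ->
  rnorm (bochner_integral mu K f - simple_integral mu K s) <= e * fine (mu K).
Proof.
move=> cf e0 hs he.
have [s0 s0_approx s0_cvg] := bochner_approx_exists cf.
have [v vE] : exists v, bochner_integral mu K f = v by eexists.
have : [set v | exists2 s, bochner_approx mu K f s &
         simple_integral mu K (s n) @[n --> \oo] --> v] (bochner_integral mu K f).
  by apply: xgetPex; exists (lim (simple_integral mu K (s0 n) @[n --> \oo])); exists s0.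
rewrite vE => -[s' [ss' _ int0] /cvg_rnormP s'v].
apply/ler_addgt0Pr => d d0; have d20 : 0 < d / 2 by rewrite divr_gt0.
have d20' : (0 < (d / 2)%:E)%E by rewrite lte_fin.
have lt_int : \forall n \near \oo,
    (\int[mu]_(t in K) (rnorm (f t - s' n t))%:E < (d / 2)%:E)%E.
  exact: (int0 _ (open_ereal_lt' d20')).
have [n [h1 h2]] : exists n, rnorm (v - simple_integral mu K (s' n)) < d / 2 /\
    (\int[mu]_(t in K) (rnorm (f t - s' n t))%:E < (d / 2)%:E)%E.
  by near \oo => n; exists n; split; near: n; [exact: s'v | exact: lt_int].
have hs' := simple_on_finite_valued (ss' n).
have := simple_integral_close cf e0 hs hs' he.
move=> /le_lt_trans /(_ (lte_leD _ h2 (lexx _))) => h3.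
have -> : v - simple_integral mu K s = (v - simple_integral mu K (s' n)) +
   (simple_integral mu K (s' n) - simple_integral mu K s) by rewrite addrA subrK.
apply: le_trans (rnormD _ _) _.
have : rnorm (simple_integral mu K (s' n) - simple_integral mu K s) <
  d / 2 + e * fine (mu K) by rewrite -lte_fin EFinD; exact: h3.
lra.
Unshelve. all: by end_near.
Qed.

End Integral.

(** The filter does not depend on f or K, so identities and inequalities between finite sums for
    several integrands pass to the integrals together. *)
Lemma bochner_integral_tagging {V : completeNormedModType R[i]} (K : set (borel G))
    (f : G -> V) : rcompact K -> continuous f ->
  fiber_sum mu K tau f @[tau --> (@tagging G)] --> bochner_integral mu K f.
Proof.
move=> hK cf; apply/cvg_rnormP => e e0.
have Koo := rcompact_fin hK; have mK : measurable K by case: hK.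
have m0 : 0 <= fine (mu K) by exact: fine_ge0.
(* The 1 covers the case of a null set K and makes the final inequality strict. *)
pose d := e / (fine (mu K) + 1).
have d0 : 0 < d by rewrite divr_gt0//; lra.
have := @tagging_near G K (fun g => [set t | rnorm (f t - f g) < d]) (proj2 hK).
move=> /(_ (fun g => near_rnorm g cf d0)); apply: filterS => tau [ht htau].
rewrite -(simple_integral_comp mK Koo)//.
apply: (@le_lt_trans _ _ (d * fine (mu K))).
  apply: bochner_integral_close => //; first exact: ltW.
    exact: finite_valued_comp.
  by move=> t /htau /= /ltW.
rewrite /d mulrAC ltr_pdivrMr; last by lra.
by rewrite ltr_pM2l//; lra.
Qed.

End BochnerContinuous.

(** * Fourier coefficients *)

Section UniformBoundedness.
Context {R : realType} {A : cstarAlgType R}.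

(* Gliding hump; in a C*-algebra the norm of the left multiplication by [j] is
   attained at [star j / |j|], up to a sign that makes it add up to [b]. *)
Lemma large_mul (j b : A) (e : R) : 0 < e ->
  exists2 c : A, rnorm (c - b) <= e & e * rnorm j <= rnorm (j *c c).
Proof.
move=> e0; have [j0|j0] := eqVneq (rnorm j) 0.
  by exists b; rewrite ?subrr ?rnorm0 ?j0 ?mulr0 ?rnorm_ge0// ltW.
have j0' : 0 < rnorm j by rewrite lt0r j0 rnorm_ge0.
pose v := (e / rnorm j) *r star j.
have vn : rnorm v = e.
  by rewrite rnormZR rnorm_star ger0_norm ?divr_ge0 ?ltW// divfK.
have jv : rnorm (j *c v) = e * rnorm j.
  rewrite cmulZr rnormZR ger0_norm ?divr_ge0 ?ltW//.
  by rewrite -{2}[j]starK rnorm_cstar rnorm_star; field.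
have [h|h] := leP (e * rnorm j) (rnorm (j *c (b + v))).
  by exists (b + v) => //; rewrite addrC addKr vn.
exists (b - v); first by rewrite addrC addKr rnormN vn.
have := rnormB (j *c (b + v)) (j *c (b - v)).
have -> : j *c (b + v) - j *c (b - v) = j *c v + j *c v.
  by rewrite -cmulBr -cmulDr opprB [b + v + _]addrC addrA subrK.
have -> : j *c v + j *c v = 2 *r (j *c v).
  by rewrite -[2]/(1 + 1) scaleCD !scale1r.
rewrite rnormZR ger0_norm// jv; lra.
Qed.

Lemma geometric_cvg (u : nat -> A) :
  (forall n, rnorm (u n.+1 - u n) <= (3^-1) ^+ n) ->
  exists l, forall n, rnorm (l - u n.+1) <= 2^-1 * (3^-1) ^+ n.
Proof.
move=> hu; set q : R := 3^-1.
(* The right-hand side is the sum of q^j for n < j <= n + k, with q = 1/3. *)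
have hk n k : rnorm (u (n.+1 + k)%N - u n.+1) <= 2^-1 * (q ^+ n - q ^+ (n + k)).
  elim: k => [|k IH]; first by rewrite !addn0 !subrr rnorm0 mulr0.
  have -> : u (n.+1 + k.+1)%N - u n.+1 =
      (u (n.+1 + k).+1 - u (n.+1 + k)%N) + (u (n.+1 + k)%N - u n.+1).
    by rewrite addrA subrK addnS.
  apply: le_trans (rnormD _ _) _.
  have := hu (n.+1 + k)%N; rewrite addnS !addSn !exprS -/q.
  rewrite {1}/q [in X in _ -> X]/q; lra.
have q0 n : 0 <= q ^+ n by rewrite exprn_ge0// invr_ge0.
have hk' n k : rnorm (u (n.+1 + k)%N - u n.+1) <= 2^-1 * q ^+ n.
  apply: le_trans (hk n k) _; have := q0 (n + k)%N; lra.
have qn0 : q ^+ n @[n --> \oo] --> (0 : R).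
  by apply: cvg_expr; rewrite ger0_norm ?invr_ge0// /q; lra.
have cu : cvg (u n @[n --> \oo]).
  apply: rnorm_cauchy_cvg => e e0.
  have /cvgrPdist_lt/(_ e e0) [n _ /(_ n (leqnn n))] := qn0.
  rewrite /= sub0r normrN ger0_norm// => qe.
  exists [set m | (n.+1 <= m)%N]; first by exists n.+1.
  move=> s t /= ns nt.
  have := hk' n (s - n.+1)%N; have := hk' n (t - n.+1)%N; rewrite !subnKC//.
  have -> : u s - u t = (u s - u n.+1) - (u t - u n.+1) by rewrite opprB addrA subrK.
  by have := rnormB (u s - u n.+1) (u t - u n.+1); lra.
exists (lim (u n @[n --> \oo])) => n.
have h : rnorm (u m - u n.+1) @[m --> \oo] --> rnorm (lim (u n @[n --> \oo]) - u n.+1).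
  by apply: cvg_rnorm; apply: cvgB => //; exact: cvg_cst.
rewrite -(cvg_lim _ h)//; apply: limr_le; first by apply/cvg_ex; eexists; exact: h.
exists n.+1 => // m /= nm; have := hk' n (m - n.+1)%N; by rewrite subnKC.
Qed.

(** Otherwise choose j_n in F with |j_n| > 2 n 3^n, and u_(n+1) within 3^-n of u_n with |j_n
    u_(n+1)| >= 3^-n |j_n|. The limit l is within 3^-n / 2 of u_(n+1), so half of the hump survives
    and |j_n l| > n for all n. *)
Lemma cmul_uniform_bounded (F : set A) :
  (forall b, exists M, forall j, F j -> rnorm (j *c b) <= M) ->
  exists2 C, 0 <= C & forall j, F j -> rnorm j <= C.
Proof.
move=> hF; apply: contrapT => hC.
have q0 (n : nat) : 0 < (3^-1 : R) ^+ n by rewrite exprn_gt0// invr_gt0.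
have hj (n : nat) : exists j, F j /\ 2 * n%:R / (3^-1) ^+ n < rnorm j.
  apply: contrapT => hn; apply: hC; exists (2 * n%:R / (3^-1) ^+ n).
    by rewrite divr_ge0 ?mulr_ge0// ltW.
  by move=> j Fj; rewrite leNgt; apply/negP => h; apply: hn; exists j.
have [j /all_and2[Fj jn]] := choice hj.
have hs (nb : nat * A) : exists c : A, rnorm (c - nb.2) <= (3^-1) ^+ nb.1 /\
    (3^-1) ^+ nb.1 * rnorm (j nb.1) <= rnorm (j nb.1 *c c).
  by have [c h1 h2] := large_mul (j nb.1) nb.2 (q0 nb.1); exists c.
have [step /all_and2[step1 step2]] := choice hs.
pose u := fix u n := if n is m.+1 then step (m, u m) else 0.
have [l hl] := geometric_cvg (u := u) (fun n => step1 (n, u n)).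
have [M hM] := hF l.
pose n := (Num.truncn `|M|).+1.
have Mn : M < n%:R by apply: le_lt_trans (ler_norm _) _; exact: truncnS_gt.
have h1 : (3^-1) ^+ n * rnorm (j n) <= rnorm (j n *c u n.+1) := step2 (n, u n).
have h2 := hM _ (Fj n); have h3 := rnorm_cmul (j n) (l - u n.+1).
have h4 := ler_wpM2l (rnorm_ge0 (j n)) (hl n).
have h5 := rnormB (j n *c l) (j n *c (l - u n.+1)).
rewrite -cmulBr subKr in h5.
have := jn n; rewrite ltr_pdivrMr// => h6.
have : (3^-1) ^+ n * rnorm (j n) = rnorm (j n) * (3^-1) ^+ n by rewrite mulrC.
lra.
Qed.

End UniformBoundedness.

(** * Fourier integrals truncated to relatively compact sets *)

Section ActionIntegral.
Context {R : realType} {G : topologicalZmodType} {A : cstarAlgType R}.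
Variable mu : {measure set (borel G) -> \bar R}.
Hypothesis mu_compact : forall K : set G, compact K -> (mu K < +oo)%E.
Variable alpha : cstar_action G A.
Implicit Types (x y z : pontryagin_dual R G) (K L D : set (borel G)).
Implicit Types a b c e : A.

Lemma conj_dual_continuous x : continuous (fun t => conjc (x t) : R[i]^o).
Proof.
move=> t; apply/cvgrPdist_lt => d d0.
have /cvgrPdist_lt/(_ d d0) := @duality_continuous _ _ x t.
by apply: filterS => s; rewrite -rmorphB/= normcJ.
Qed.

Lemma conj_dual_norm x t : `|conjc (x t) : R[i]^o| = 1.
Proof. by rewrite normcJ; exact: duality_norm. Qed.

Lemma conj_dualD x s t : conjc (x (s + t)) = conjc (x s) * conjc (x t).
Proof. by rewrite dualityD; exact: rmorphM. Qed.

(** The inverse of x in the dual group, as x is unimodular. *)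
Definition dualV x : pontryagin_dual R G :=
  Dual (@conj_dual_continuous x) (conj_dual_norm x) (conj_dualD x).

Lemma dual_mul_conj x t : (x t : R[i]) * conjc (x t) = 1.
Proof.
by rewrite -sqr_normc (_ : `|x t : R[i]| = 1) ?expr1n//; exact: duality_norm.
Qed.

Definition action_int K x a : A :=
  bochner_integral mu K (fun t : G => x t *: alpha t a).

Definition action_sum K (tau : borel G -> G) x a : A :=
  fiber_sum mu K tau (fun t : G => x t *: alpha t a).

Lemma action_scale_continuous x a : continuous (fun t : G => x t *: alpha t a).
Proof.
move=> t; apply: cvgZ; last exact: act_continuous.
exact: (@duality_continuous _ _ x t).
Qed.

Lemma action_int_cvg K x a : rcompact K ->
  action_sum K tau x a @[tau --> (@tagging G)] --> action_int K x a.
Proof.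
move=> hK; apply: bochner_integral_tagging => //.
exact: action_scale_continuous.
Qed.

Arguments action_int_cvg [K] x a _.

Lemma action_int_mulr K x a b : rcompact K ->
  bochner_integral mu K (fun t : G => x t *: (alpha t a *c b)) =
  action_int K x a *c b.
Proof.
move=> hK; have E : (fun t : G => x t *: (alpha t a *c b)) =
    (fun t : G => (x t *: alpha t a) *c b).
  by apply/funext => t; rewrite cmulZl.
apply: (rnorm_eq_lim (F := @tagging G)).
  apply: bochner_integral_tagging => //; rewrite E => t.
  by apply: cvg_cmul; [exact: action_scale_continuous | exact: cvg_cst].
rewrite E; apply: (cvg_trans _ (cvg_cmul (action_int_cvg x a hK) (cvg_cst b))).
apply: near_eq_cvg; apply: nearW => tau.
by rewrite cmul_suml; apply: eq_bigr => g _; rewrite cmulZl.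
Qed.

Lemma action_int_mull K x a b : rcompact K ->
  bochner_integral mu K (fun t : G => x t *: (b *c alpha t a)) =
  b *c action_int K x a.
Proof.
move=> hK; have E : (fun t : G => x t *: (b *c alpha t a)) =
    (fun t : G => b *c (x t *: alpha t a)).
  by apply/funext => t; rewrite cmulZr.
apply: (rnorm_eq_lim (F := @tagging G)).
  apply: bochner_integral_tagging => //; rewrite E => t.
  by apply: cvg_cmul; [exact: cvg_cst | exact: action_scale_continuous].
rewrite E; apply: (cvg_trans _ (cvg_cmul (cvg_cst b) (action_int_cvg x a hK))).
apply: near_eq_cvg; apply: nearW => tau.
by rewrite cmul_sumr; apply: eq_bigr => g _; rewrite cmulZr.
Qed.

Lemma action_int_ext K x y a : (forall t, x t = y t) ->
  action_int K x a = action_int K y a.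
Proof.
by move=> xy; congr bochner_integral; apply/funext => t; rewrite xy.
Qed.

Lemma tagging_finite_valued :
  \forall tau \near @tagging G, finite_valued (tau : borel G -> G).
Proof.
exists (set0, fun=> setT); last by move=> tau [].
by split; [exact: (proj2 rcompact0) | move=> g; exact: filterT].
Qed.

Lemma action_int_setU K L x a : rcompact K -> rcompact L -> K `&` L = set0 ->
  action_int (K `|` L) x a = action_int K x a + action_int L x a.
Proof.
move=> hK hL KL; apply: (rnorm_eq_lim (F := @tagging G)).
  exact: (action_int_cvg x a (rcompactU hK hL)).
apply: (cvg_trans _ (cvgD (action_int_cvg x a hK) (action_int_cvg x a hL))).
apply: near_eq_cvg; apply: filterS tagging_finite_valued => tau ht.
rewrite /action_sum /fiber_sum fctE -big_split/=; apply: eq_bigr => g _.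
rewrite fiber_measureD// ?scaleCD//; try exact: rcompact_fin.
  by case: hK.
by case: hL.
Qed.

Lemma action_int_setD K L x a : rcompact K -> rcompact L -> K `<=` L ->
  action_int (L `\` K) x a = action_int L x a - action_int K x a.
Proof.
move=> hK hL KL; rewrite -{2}(setDUK KL) action_int_setU//.
- by rewrite addrC addKr.
- exact: rcompactD.
- by rewrite setDIK.
Qed.

Lemma star_action_int K x a : rcompact K ->
  star (action_int K x a) = action_int K (dualV x) (star a).
Proof.
move=> hK; apply: (rnorm_eq_lim (F := @tagging G)).
  exact: cvg_star (action_int_cvg x a hK).
apply: (cvg_trans _ (action_int_cvg (dualV x) (star a) hK)).
apply: near_eq_cvg; apply: nearW => tau.
rewrite /action_sum /fiber_sum star_sum; apply: eq_bigr => g _.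
by rewrite starZR star_scale act_star.
Qed.

Lemma act_is_positive t a : is_positive a -> is_positive (alpha t a).
Proof. by move=> [h ->]; exists (alpha t h); rewrite actM act_star. Qed.

Lemma actB t a b : alpha t (a - b) = alpha t a - alpha t b.
Proof.
have := act_linear alpha t (-1) b a; rewrite !scaleN1r => E.
by rewrite addrC E addrC.
Qed.

(** The Riemann sum over L is the one over K plus the one over the rest, both positive. *)
Lemma action_int_norm_le K L a : rcompact K -> rcompact L -> K `<=` L ->
  is_positive a ->
  rnorm (action_int K dual1 a) <= rnorm (action_int L dual1 a).
Proof.
move=> hK hL KL a0.
have cn D : rcompact D -> rnorm (action_sum D tau dual1 a) @[tau --> (@tagging G)] -->
    rnorm (action_int D dual1 a).
  by move=> hD; exact: cvg_rnorm (action_int_cvg dual1 a hD).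
apply: (ler_lim_near (cn K hK) (cn L hL)).
apply: filterS tagging_finite_valued => tau ht.
have nn D : nonneg (action_sum D tau dual1 a).
  apply: nonneg_sum => g _; apply: nonnegZ; first exact: fiber_measure_ge0.
  rewrite scale1r; apply: is_positive_nonneg; exact: act_is_positive.
have -> : action_sum L tau dual1 a =
    action_sum K tau dual1 a + action_sum (L `\` K) tau dual1 a.
  rewrite -{1}(setDUK KL) /action_sum /fiber_sum -big_split/=.
  apply: eq_bigr => g _; have hD := rcompactD hL hK.
  rewrite fiber_measureD// ?scaleCD//; try exact: rcompact_fin.
  - by case: hK.
  - by case: hD.
  - by rewrite setDIK.
exact: nonneg_norm_le.
Qed.

(* Cauchy-Schwarz for [xi t = z t *: e - e'], after bounding [a] by [b]. *)
Lemma action_int_dominated K x z a b e e' : rcompact K ->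
  is_positive a -> cle a b ->
  rnorm (action_int K (dualM x z) a *c e - action_int K x a *c e') ^+ 2 <=
  rnorm (action_int K dual1 a) *
  rnorm (star e *c (action_int K (dualM (dualV z) z) b *c e
                    - action_int K (dualV z) b *c e')
       - star e' *c (action_int K (dualM dual1 z) b *c e
                    - action_int K dual1 b *c e')).
Proof.
move=> hK [h ah] [g bg].
pose f y c := action_int_cvg y c hK.
have fe y c d : action_sum K tau y c *c d @[tau --> (@tagging G)] -->
    action_int K y c *c d by apply: cvg_cmul (f y c) (cvg_cst d).
have cvg_l : rnorm (action_sum K tau (dualM x z) a *c e
                   - action_sum K tau x a *c e') ^+ 2 @[tau --> (@tagging G)]
    --> rnorm (action_int K (dualM x z) a *c e - action_int K x a *c e') ^+ 2.
  by apply: cvgM; apply: cvg_rnorm; apply: cvgB; exact: fe.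
have cvg_r : rnorm (action_sum K tau dual1 a) *
     rnorm (star e *c (action_sum K tau (dualM (dualV z) z) b *c e
                    - action_sum K tau (dualV z) b *c e')
       - star e' *c (action_sum K tau (dualM dual1 z) b *c e
                    - action_sum K tau dual1 b *c e')) @[tau --> (@tagging G)] -->
   rnorm (action_int K dual1 a) *
  rnorm (star e *c (action_int K (dualM (dualV z) z) b *c e
                    - action_int K (dualV z) b *c e')
       - star e' *c (action_int K (dualM dual1 z) b *c e
                    - action_int K dual1 b *c e')).
  apply: cvgM; apply: cvg_rnorm; first exact: f.
  by apply: cvgB; apply: cvg_cmul (cvg_cst _) _; apply: cvgB; exact: fe.
apply: (ler_lim_near cvg_l cvg_r).
apply: nearW => tau.
pose r := fset_set (range tau) : seq G.
pose xi t : A := z t *: e - e'.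
have := @weighted_sum_dominated R A G r (fiber_measure mu K tau)
  (fiber_measure_ge0 mu K tau) (fun t => alpha t a) (fun t => alpha t b)
  (fun t => alpha t h) (fun t => alpha t g) xi (fun t => x t).
move=> /(_ _ _ (dual_mul_conj x)).
have -> : \sum_(i <- r) fiber_measure mu K tau i *r (x i *: (alpha i a *c xi i)) =
    action_sum K tau (dualM x z) a *c e - action_sum K tau x a *c e'.
  rewrite /action_sum /fiber_sum !cmul_suml -sumrB; apply: eq_bigr => i _.
  rewrite !cmulZl cmulBr cmulZr -scalerBr; congr (_ *: _).
  by rewrite scalerBr scalerA.
have -> : \sum_(i <- r) fiber_measure mu K tau i *r alpha i a = action_sum K tau dual1 a.
  by rewrite /action_sum /fiber_sum; apply: eq_bigr => i _; rewrite [dual1 i *: _]scale1r.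
(* Expand the adjoint of z e - e'. The characters z^-1 z and 1 z are left unsimplified, so that both
   brackets have the shape found in [rel_continuous], at z^-1 and at 1. *)
have -> : \sum_(i <- r) fiber_measure mu K tau i *r (star (xi i) *c alpha i b *c xi i) =
   star e *c (action_sum K tau (dualM (dualV z) z) b *c e
                    - action_sum K tau (dualV z) b *c e')
       - star e' *c (action_sum K tau (dualM dual1 z) b *c e
                    - action_sum K tau dual1 b *c e').
  rewrite /action_sum /fiber_sum !cmul_suml -!sumrB !cmul_sumr -sumrB.
  apply: eq_bigr => i _; rewrite !cmulZl -!scalerBr !cmulZr -scalerBr.
  congr (_ *: _); rewrite /xi starB star_scale !cmulBl; congr (_ - _).
    by rewrite !cmulZl -cmulA cmulBr cmulZr -cmulZr scalerBr scalerA.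
  rewrite -cmulA cmulBr cmulZr [dual1 i *: _]scale1r.
  by rewrite (_ : dualM dual1 z i = z i)//; exact: mul1r.
apply.
- by move=> t; rewrite ah actM act_star.
- by move=> t; rewrite -actB bg actM act_star.
Qed.

End ActionIntegral.

(** * Convergence to the Fourier coefficients *)

Section FourierLimits.
Context {R : realType} {G : topologicalZmodType} {A : cstarAlgType R}.
Variable mu : {measure set (borel G) -> \bar R}.
Hypothesis mu_compact : forall K : set G, compact K -> (mu K < +oo)%E.
Variable alpha : cstar_action G A.
Implicit Types (x y z : pontryagin_dual R G) (K L D : set (borel G)).
Implicit Types b c e : A.

Local Notation net := (@rcompact_net G).
Local Notation action_int := (action_int mu alpha).

Lemma rcompact_net_near K : rcompact K ->
  \forall L \near net, rcompact L /\ K `<=` L.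
Proof. by move=> hK; exists K. Qed.

Lemma rcompact_near : \forall L \near net, rcompact L.
Proof. by apply: filterS (rcompact_net_near rcompact0) => L []. Qed.

Lemma net_cvgP (f : set (borel G) -> A) (l : A) : f @ net --> l <->
  forall d : R, 0 < d -> exists2 K, rcompact K &
    forall L, rcompact L -> K `<=` L -> rnorm (l - f L) < d.
Proof.
split=> [/cvg_rnormP h d d0|h].
  by have [K hK hL] := h d d0; exists K => // L cL KL; exact: hL.
apply/cvg_rnormP => d d0; have [K hK hL] := h d d0.
by exists K => // L [cL KL]; exact: hL.
Qed.

Variable a : A.
Hypotheses (a_pos : is_positive a) (a_int : action_integrable mu alpha a).

Lemma action_int1_cvg b : cvg (action_int K dual1 a *c b @[K --> net]).
Proof.
have [[_ h] _] := a_int b; apply/cvg_ex; eexists.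
apply: (cvg_trans _ h); apply: near_eq_cvg; apply: filterS rcompact_near => K hK.
rewrite -(action_int_mulr mu_compact alpha _ _ _ hK); congr bochner_integral.
by apply/funext => t; rewrite [dual1 t *: _]scale1r.
Qed.

Arguments action_int1_cvg : clear implicits.

(** Uniform boundedness needs a bound for every K, whereas convergence gives one only beyond some
    K0. The integral over K differs from that over the union with K0 by an integral over a part of
    K0, bounded by monotonicity. *)
Lemma action_int_bounded : exists2 C, 0 <= C &
  forall K, rcompact K -> rnorm (action_int K dual1 a) <= C.
Proof.
have [|C C0 hC] := @cmul_uniform_bounded R A
    [set action_int K dual1 a | K in [set K | rcompact K]].
  move=> b; have /cvg_ex[l /net_cvgP/(_ 1 ltr01)[K0 hK0 hl]] := action_int1_cvg b.
  exists (rnorm l + 1 + rnorm (action_int K0 dual1 a) * rnorm b).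
  move=> _ [K /= hK <-]; have hU := rcompactU hK hK0.
  have hD := rcompactD hU hK.
  have -> : action_int K dual1 a *c b = l
      - (l - action_int (K `|` K0) dual1 a *c b)
      - action_int ((K `|` K0) `\` K) dual1 a *c b.
    rewrite subKr (action_int_setD _ _ _ _ hK hU) => [|//|]; last exact: subsetUl.
    by rewrite cmulBl subKr.
  have h1 := hl _ hU (@subsetUr _ _ _).
  have h2 : rnorm (action_int ((K `|` K0) `\` K) dual1 a) <=
      rnorm (action_int K0 dual1 a).
    apply: action_int_norm_le => //.
    by move=> t [[Kt|//] nKt]; case: nKt.
  apply: le_trans (rnormB _ _) _; apply: lerD.
    by apply: le_trans (rnormB _ _) _; rewrite lerD2l ltW.
  apply: le_trans (rnorm_cmul _ _) _.
  by rewrite ler_wpM2r// rnorm_ge0.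
by exists C => // K hK; apply: hC; exists K.
Qed.

(** This is [action_int_dominated] with a dominated by itself, z trivial and e' = 0. It controls
    every character by the trivial one. *)
Lemma action_int_cauchy_schwarz K x b : rcompact K ->
  rnorm (action_int K x a *c b) ^+ 2 <= rnorm (action_int K dual1 a) *
    (rnorm b * rnorm (action_int K dual1 a *c b)).
Proof.
move=> hK; have aa : cle a a by exists 0; rewrite subrr cmul0r.
have E1 : action_int K (dualM x dual1) a = action_int K x a.
  by apply: action_int_ext => t; exact: mulr1.
have E2 : action_int K (dualM (dualV dual1) dual1) a = action_int K dual1 a.
  by apply: action_int_ext => t; rewrite [LHS]mulr1; exact: conjc1.
have := action_int_dominated mu_compact alpha x dual1 b 0 hK a_pos aa.
rewrite E1 E2; move: (action_int K x a) (action_int K dual1 a) => u v.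
move: (action_int K _ a) (action_int K _ a) => u' v'.
rewrite star0 cmul0l !cmul0r !subr0 => /le_trans; apply.
apply: ler_wpM2l; first exact: rnorm_ge0.
by apply: le_trans (rnorm_cmul _ _) _; rewrite rnorm_star.
Qed.

Lemma action_int_mul_bounded C : 0 <= C ->
  (forall K, rcompact K -> rnorm (action_int K dual1 a) <= C) ->
  forall K x b, rcompact K -> rnorm (action_int K x a *c b) <= C * rnorm b.
Proof.
move=> C0 hC K x b hK.
rewrite -(ler_pXn2r (n := 2)) ?nnegrE ?mulr_ge0 ?rnorm_ge0//.
apply: le_trans (action_int_cauchy_schwarz x b hK) _.
have h1 := rnorm_cmul (action_int K dual1 a) b; have h2 := hC K hK.
have b0 := rnorm_ge0 b; have j0 := rnorm_ge0 (action_int K dual1 a).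
have h3 : rnorm (action_int K dual1 a *c b) <= C * rnorm b.
  by apply: le_trans h1 _; rewrite ler_wpM2r.
rewrite exprMn expr2 -mulrA ler_pM ?mulr_ge0 ?rnorm_ge0//.
by rewrite expr2 mulrCA ler_wpM2l.
Qed.

(** Integrability concerns the trivial character; Cauchy-Schwarz over the difference sets carries
    the Cauchy property to x. *)
Lemma action_int_net_cvg x b : cvg (action_int K x a *c b @[K --> net]).
Proof.
have [C C0 hC] := action_int_bounded.
have /cvg_ex[l /net_cvgP hl] := action_int1_cvg b.
apply: rnorm_cauchy_cvg => d d0.
pose B := C * rnorm b + 1; have b0 := rnorm_ge0 b.
have B0 : 0 < B by rewrite /B; have := mulr_ge0 C0 b0; lra.
(* The last halving pays for comparing two integrals through l; as C |b| < B, the Cauchy-Schwarz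
   bound stays below (d / 2)^2. *)
have d20 : 0 < (d / 2) ^+ 2 / B / 2.
  by rewrite !divr_gt0// exprn_gt0// divr_gt0.
have [K0 hK0 hK] := hl _ d20.
have small L : rcompact L -> K0 `<=` L ->
    rnorm (action_int L x a *c b - action_int K0 x a *c b) < d / 2.
  move=> hL KL; rewrite -cmulBl -action_int_setD//.
  have hD := rcompactD hL hK0.
  rewrite -(ltr_pXn2r (n := 2)) ?nnegrE ?rnorm_ge0//; last by rewrite divr_ge0// ltW.
  apply: le_lt_trans (action_int_cauchy_schwarz x b hD) _.
  have h1 : rnorm (action_int (L `\` K0) dual1 a *c b) <= (d / 2) ^+ 2 / B.
    rewrite action_int_setD// cmulBl.
    have -> : action_int L dual1 a *c b - action_int K0 dual1 a *c b =
       (l - action_int K0 dual1 a *c b) - (l - action_int L dual1 a *c b).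
      by rewrite opprB [RHS]addrC addrA subrK.
    apply: le_trans (rnormB _ _) _.
    have := hK _ hL KL; have := hK _ hK0 (@subset_refl _ _); lra.
  have h2 := hC _ hD.
  apply: (@le_lt_trans _ _ (C * (rnorm b * ((d / 2) ^+ 2 / B)))).
    rewrite ler_pM ?mulr_ge0 ?rnorm_ge0//.
    by rewrite ler_wpM2l.
  have -> : C * (rnorm b * ((d / 2) ^+ 2 / B)) = (d / 2) ^+ 2 * (C * rnorm b) / B.
    by rewrite [C * _]mulrA [LHS]mulrA (mulrC (C * rnorm b)).
  by rewrite ltr_pdivrMr// ltr_pM2l ?exprn_gt0 ?divr_gt0// ltrDl.
exists [set L | rcompact L /\ K0 `<=` L]; first exact: rcompact_net_near.
move=> L M [hL KL] [hM KM].
have -> : action_int L x a *c b - action_int M x a *c b =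
   (action_int L x a *c b - action_int K0 x a *c b)
   - (action_int M x a *c b - action_int K0 x a *c b).
  by rewrite opprB addrA subrK.
apply: le_lt_trans (rnormB _ _) _.
have := small _ hL KL; have := small _ hM KM; lra.
Qed.

Arguments action_int_net_cvg : clear implicits.

Lemma star_positive : star a = a.
Proof. by have [h ->] := a_pos; rewrite starM starK. Qed.

Definition lim_lmult x b : A := lim (action_int K x a *c b @[K --> net]).
(** As a is self-adjoint, the adjoint of E_x(a) is its coefficient at x^-1; the right action thus
    inherits its properties from the left one. *)
Definition lim_rmult x b : A := star (lim_lmult (dualV x) (star b)).

Lemma lim_lmultP x b : action_int K x a *c b @[K --> net] --> lim_lmult x b.
Proof. exact: action_int_net_cvg. Qed.

Arguments lim_lmultP : clear implicits.

Lemma lim_rmultP x b : b *c action_int K x a @[K --> net] --> lim_rmult x b.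
Proof.
apply: (cvg_trans _ (cvg_star (lim_lmultP (dualV x) (star b)))).
apply: near_eq_cvg; apply: filterS rcompact_near => K hK.
have E : action_int K (dualV (dualV x)) a = action_int K x a.
  by apply: action_int_ext => t; exact: conjcK.
by rewrite starM starK (star_action_int mu_compact alpha _ _ hK) star_positive E.
Qed.

Arguments lim_rmultP : clear implicits.

Lemma lim_lmult_linear x : linear (lim_lmult x).
Proof.
move=> k b c; apply: (rnorm_eq_lim (lim_lmultP x _)).
have h : k *: (action_int K x a *c b) + action_int K x a *c c @[K --> net] -->
    k *: lim_lmult x b + lim_lmult x c.
  apply: cvgD; last exact: lim_lmultP.
  by apply: cvgZ; [exact: cvg_cst | exact: lim_lmultP].
apply: (cvg_trans _ h); apply: near_eq_cvg; apply: nearW => K.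
by rewrite cmulDr cmulZr.
Qed.

Lemma lim_rmult_linear x : linear (lim_rmult x).
Proof.
move=> k b c; rewrite /lim_rmult starD star_scale lim_lmult_linear.
by rewrite starD star_scale conjcK.
Qed.

Lemma lim_lmult_bounded C : 0 <= C ->
  (forall K, rcompact K -> rnorm (action_int K dual1 a) <= C) ->
  forall x b, rnorm (lim_lmult x b) <= C * rnorm b.
Proof.
move=> C0 hC x b.
have h : rnorm (action_int K x a *c b) @[K --> net] --> rnorm (lim_lmult x b).
  by apply: cvg_rnorm; exact: lim_lmultP.
apply: (ler_lim_near h (cvg_cst (C * rnorm b))).
apply: filterS rcompact_near => K hK; exact: action_int_mul_bounded.
Qed.

Lemma lim_lmult_continuous x : continuous (lim_lmult x).
Proof.
have [C C0 hC] := action_int_bounded.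
move=> b; apply/cvg_rnormP => d d0.
have C1 : 0 < C + 1 by lra.
have d1 : 0 < d / (C + 1) by rewrite divr_gt0.
have /cvg_rnormP/(_ _ d1) := @cvg_id _ (nbhs b); apply: filterS => c hc.
have -> : lim_lmult x b - lim_lmult x c = lim_lmult x (b - c).
  by rewrite -scaleN1r addrC -lim_lmult_linear scaleN1r addrC.
apply: le_lt_trans (lim_lmult_bounded C0 hC _ _) _.
move: hc; rewrite ltr_pdivlMr// => hc; have := rnorm_ge0 (b - c); lra.
Qed.

Lemma lim_rmult_continuous x : continuous (lim_rmult x).
Proof.
move=> b; apply: cvg_star.
apply: (@continuous_comp _ _ _ (@star R A) (lim_lmult (dualV x))).
  by apply: cvg_star; exact: cvg_id.
exact: lim_lmult_continuous.
Qed.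

Let lim_lmult_lin x : {linear A -> A} :=
  HB.pack (lim_lmult x) (GRing.isLinear.Build _ _ _ _ _ (lim_lmult_linear x)).
Let lim_rmult_lin x : {linear A -> A} :=
  HB.pack (lim_rmult x) (GRing.isLinear.Build _ _ _ _ _ (lim_rmult_linear x)).

Lemma lim_lmultM x b c : lim_lmult x (b *c c) = lim_lmult x b *c c.
Proof.
apply: (rnorm_eq_lim (lim_lmultP x _)).
apply: (cvg_trans _ (cvg_cmul (lim_lmultP x b) (cvg_cst c))).
by apply: near_eq_cvg; apply: nearW => K; rewrite cmulA.
Qed.

Lemma lim_rmultM x b c : lim_rmult x (b *c c) = b *c lim_rmult x c.
Proof. by rewrite /lim_rmult starM lim_lmultM starM starK. Qed.

Lemma lim_multE x b c : b *c lim_lmult x c = lim_rmult x b *c c.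
Proof.
apply: (rnorm_eq_lim (cvg_cmul (cvg_cst b) (lim_lmultP x c))).
apply: (cvg_trans _ (cvg_cmul (lim_rmultP x b) (cvg_cst c))).
by apply: near_eq_cvg; apply: nearW => K; rewrite cmulA.
Qed.

Definition lim_mult x : multiplier A :=
  @Multiplier R A (lim_lmult_lin x) (lim_rmult_lin x)
    (@lim_lmult_continuous x) (@lim_rmult_continuous x)
    (lim_lmultM x) (lim_rmultM x) (lim_multE x).

(** [lim_mult] satisfies the equations that define the coefficient, so [fourier] does not fall back
    on its default. *)
Lemma lmult_fourier x b : lmult (fourier mu alpha x a) b = lim_lmult x b.
Proof.
pose P := [set m : multiplier A | forall b : A,
    lmult m b = uncond_integral mu (fun t => x t *: (alpha t a *c b)) /\
    rmult m b = uncond_integral mu (fun t => x t *: (b *c alpha t a))].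
have El c : uncond_integral mu (fun t => x t *: (alpha t a *c c)) = lim_lmult x c.
  apply: (cvg_lim (@norm_hausdorff _ A)).
  apply: (cvg_trans _ (lim_lmultP x c)).
  apply: near_eq_cvg; apply: filterS rcompact_near => K hK.
  by rewrite (action_int_mulr mu_compact alpha _ _ _ hK).
have Er c : uncond_integral mu (fun t => x t *: (c *c alpha t a)) = lim_rmult x c.
  apply: (cvg_lim (@norm_hausdorff _ A)).
  apply: (cvg_trans _ (lim_rmultP x c)).
  apply: near_eq_cvg; apply: filterS rcompact_near => K hK.
  by rewrite (action_int_mull mu_compact alpha _ _ _ hK).
have : P (fourier mu alpha x a).
  by apply: xgetPex; exists (lim_mult x) => c; rewrite El Er.
by move=> /(_ b)[-> _].
Qed.

Lemma lmult_fourier_cvg x b :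
  action_int K x a *c b @[K --> net] --> lmult (fourier mu alpha x a) b.
Proof. by rewrite lmult_fourier; exact: lim_lmultP. Qed.

Lemma lmult_fourier_bounded : exists2 C, 0 <= C &
  (forall K, rcompact K -> rnorm (action_int K dual1 a) <= C) /\
  forall x b, rnorm (lmult (fourier mu alpha x a) b) <= C * rnorm b.
Proof.
have [C C0 hC] := action_int_bounded; exists C => //; split => // x b.
by rewrite lmult_fourier; exact: lim_lmult_bounded.
Qed.

End FourierLimits.

Section MultiplierNorm.
Context {R : realType} {A : cstarAlgType R}.

(** A continuous linear map is bounded, which makes the [sup] in [mult_norm] a true supremum. *)
Lemma le_mult_norm (m : multiplier A) (b : A) :
  rnorm (lmult m b) <= mult_norm m * rnorm b.
Proof.
have /linear_bounded_continuous/linear_boundedP/pinfty_ex_gt0[r r0 hr] :=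
  @lmult_continuous _ _ m.
apply: (le_opnorm (M := complex.Re r)) => [k c|c]; first exact: linearZ.
have := hr c; rewrite !rnormE -[r in X in X -> _]RRe_real ?gtr0_real//.
by rewrite -rmorphM lecR.
Qed.

Lemma mult_norm_le (m : multiplier A) (M : R) : 0 <= M ->
  (forall b, rnorm (lmult m b) <= M * rnorm b) -> mult_norm m <= M.
Proof. exact: opnorm_le. Qed.

End MultiplierNorm.

Theorem proposition8p4 (R : realType) (G : topologicalZmodType)
  (hausdorffG : hausdorff_space G) (lcG : locally_compact [set: G])
  (mu : {measure set (borel G) -> \bar R}) (haar_mu : is_haar mu)
  (A : cstarAlgType R) (alpha : cstar_action G A) (a b c : A)
  (a_pos : is_positive a) (b_pos : is_positive b) (c_pos : is_positive c)
  (a_int : action_integrable mu alpha a)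
  (b_int : action_integrable mu alpha b)
  (c_int : action_integrable mu alpha c)
  (le_ab : cle a b)
  (rc_bc : rel_continuous mu alpha b c) :
  rel_continuous mu alpha a c.
Proof.
have mu_compact K : compact K -> (mu K < +oo)%E by case: haar_mu => _ _ + _ _; apply.
have [Ca Ca0 [hCa _]] := lmult_fourier_bounded mu_compact a_pos a_int.
have [Cc Cc0 [_ hCc]] := lmult_fourier_bounded mu_compact c_pos c_int.
have hEa := lmult_fourier_cvg mu_compact a_pos a_int.
have hEb := lmult_fourier_cvg mu_compact b_pos b_int.
(* The square of the norm will be at most 2 Ca Cc d |v|^2, and d is such that B d = (eps / 2)^2; the
   1 keeps B positive. *)
move=> eps eps0; pose B := 2 * Ca * Cc + 1.
have B0 : 0 < B by rewrite /B; have := mulr_ge0 Ca0 Cc0; lra.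
pose d := (eps / 2) ^+ 2 / B.
have d0 : 0 < d by rewrite divr_gt0// exprn_gt0// divr_gt0.
apply: filterS (rc_bc d d0) => z hz x y.
apply: (@le_lt_trans _ _ (eps / 2)); last by lra.
apply: mult_norm_le => [|v]; first by rewrite divr_ge0// ltW.
pose e := lmult (fourier mu alpha y c) v.
pose e' := lmult (fourier mu alpha (dualM z y) c) v.
pose T w u := lmult (fourier mu alpha w b) u.
have he : rnorm e <= Cc * rnorm v by exact: hCc.
have he' : rnorm e' <= Cc * rnorm v by exact: hCc.
(* Uniformity in the first character is essential: w will be z^-1, which moves with z. *)
have small w : rnorm (T (dualM w z) e - T w e') <= d * rnorm v.
  have := le_mult_norm (multB (multM (fourier mu alpha (dualM w z) b) (fourier mu alpha y c))
    (multM (fourier mu alpha w b) (fourier mu alpha (dualM z y) c))) v.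
  move=> /le_trans; apply; rewrite ler_wpM2r ?rnorm_ge0//; exact: ltW.
(* The truncated integrals converge only after multiplication by a vector, so the norm of the one of
   a at the trivial character is replaced by its bound Ca before passing to the limit. *)
have main : rnorm (lmult (fourier mu alpha (dualM x z) a) e
                   - lmult (fourier mu alpha x a) e') ^+ 2 <=
  Ca * rnorm (star e *c (T (dualM (dualV z) z) e - T (dualV z) e')
    - star e' *c (T (dualM dual1 z) e - T dual1 e')).
  have cl : rnorm (action_int mu alpha K (dualM x z) a *c e
      - action_int mu alpha K x a *c e') ^+ 2 @[K --> @rcompact_net G] -->
      rnorm (lmult (fourier mu alpha (dualM x z) a) e
                   - lmult (fourier mu alpha x a) e') ^+ 2.
    by apply: cvgM; apply: cvg_rnorm; apply: cvgB; exact: hEa.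
  have cr : Ca * rnorm (star e *c (action_int mu alpha K (dualM (dualV z) z) b *c e
                    - action_int mu alpha K (dualV z) b *c e')
       - star e' *c (action_int mu alpha K (dualM dual1 z) b *c e
                    - action_int mu alpha K dual1 b *c e')) @[K --> @rcompact_net G] -->
     Ca * rnorm (star e *c (T (dualM (dualV z) z) e - T (dualV z) e')
    - star e' *c (T (dualM dual1 z) e - T dual1 e')).
    apply: cvgM; first exact: cvg_cst.
    apply: cvg_rnorm; apply: cvgB; apply: cvg_cmul; try exact: cvg_cst.
      by apply: cvgB; exact: hEb.
    by apply: cvgB; exact: hEb.
  apply: (ler_lim_near cl cr); apply: filterS (@rcompact_near G) => K hK.
  apply: le_trans (action_int_dominated mu_compact alpha x z e e' hK a_pos le_ab) _.
  by apply: ler_wpM2r; [exact: rnorm_ge0 | exact: hCa].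
rewrite -(ler_pXn2r (n := 2)) ?nnegrE ?rnorm_ge0 ?mulr_ge0 ?rnorm_ge0 ?invr_ge0//; last first.
  exact: ltW.
apply: le_trans main _.
have v0 := rnorm_ge0 v.
have bound (u w : A) : rnorm u <= Cc * rnorm v -> rnorm w <= d * rnorm v ->
    rnorm (star u *c w) <= Cc * d * rnorm v ^+ 2.
  move=> hu hw; apply: le_trans (rnorm_cmul _ _) _; rewrite rnorm_star.
  have -> : Cc * d * rnorm v ^+ 2 = (Cc * rnorm v) * (d * rnorm v) by ring.
  by apply: ler_pM => //; exact: rnorm_ge0.
have h1 := bound _ _ he (small (dualV z)).
have h2 := bound _ _ he' (small dual1).
have h3 := rnormB (star e *c (T (dualM (dualV z) z) e - T (dualV z) e'))
  (star e' *c (T (dualM dual1 z) e - T dual1 e')).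
have h4 := le_trans h3 (lerD h1 h2).
apply: le_trans (ler_wpM2l Ca0 h4) _.
have -> : Ca * (Cc * d * rnorm v ^+ 2 + Cc * d * rnorm v ^+ 2)
    = (2 * Ca * Cc) * d * rnorm v ^+ 2 by ring.
rewrite exprMn; apply: ler_wpM2r; first exact: sqr_ge0.
have -> : (eps / 2) ^+ 2 = B * d by rewrite /d [RHS]mulrC divfK// gt_eqF.
by apply: ler_wpM2r; [exact: ltW | rewrite /B lerDl].
Qed.
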